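(* Let $P$ be a closed polygonal curve embedded in $\mathbb{R}^4$ consisting of $n$ line segments. Then there exists a complementary immersed triangulated PL disk in $\mathbb{R}^4$ that is locally flat, has $P$ as its PL boundary, and contains $3n$ triangles.
   Context: A closed polygonal curve with $n$ line segments embedded in $\mathbb{R}^4$ is a simple closed curve that is a cyclic union of $n$ straight line segments (edges). An immersed triangulated PL disk in $\mathbb{R}^4$ is a topological closed 2-disk $S$ with a finite triangulation, together with a map $S \to \mathbb{R}^4$ that is affine and injective on each triangle and is locally injective (an immersion). It is complementary immersed if the map is an embedding on the boundary $\partial S$ and the image of the interior of $S$ is disjoint from the image of $\partial S$. It has $P$ as its PL boundary if $\partial S$ maps onto $P$ with the edges of $\partial S$ mapping exactly to the $n$ edges of $P$ (no subdivision). Local flatness: a surface $\Sigma$ embedded in $\mathbb{R}^d$ is locally flat if each point $x \in \Sigma$ has a neighborhood $N$ in $\mathbb{R}^d$ such that the pair $(N, N \cap \Sigma)$ is homeomorphic to $(D \times I^{d-2}, D \times \{0\}^{d-2})$, where $D$ is a 2-disk and $I=[-1,1]$, when $x$ is an interior point of $\Sigma$, with $D \times \{0\}^{d-2}$ replaced by $D^+ \times \{0\}^{d-2}$, where $D^+ \subset D$ is a half-disk with $x$ corresponding to a point of its diameter, when $x$ is a boundary point of $\Sigma$. For an immersed surface, local flatness is required of each sheet separately, i.e. each point of $S$ has a neighborhood in $S$ whose image is embedded and locally flat at the image point. *)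

(* Defs.v *)
From HB Require Import structures.
From mathcomp Require Import all_boot all_order all_algebra.
From mathcomp Require Import all_classical all_reals all_analysis.

Set Implicit Arguments.
Unset Strict Implicit.
Unset Printing Implicit Defensive.

Import Order.TTheory GRing.Theory Num.Theory.
Import numFieldNormedType.Exports.

Local Open Scope classical_set_scope.
Local Open Scope ring_scope.

Section Topology.

Definition homeomorphism_on (X Y : topologicalType) (A : set X) (B : set Y)
    (f : X -> Y) : Prop :=
  exists g : Y -> X,
    [/\ {within A, continuous f} /\ {within B, continuous g},
        set_fun A B f, set_fun B A g,
        {in A, cancel f g} & {in B, cancel g f}].

Definition embedding_on (X Y : topologicalType) (A : set X) (f : X -> Y) :
    Prop :=
  homeomorphism_on A (f @` A) f.

Variable R : realType.

Definition disk : set 'rV[R]_2 := [set z | \sum_i z 0 i ^+ 2 <= 1].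
Definition circle : set 'rV[R]_2 := [set z | \sum_i z 0 i ^+ 2 = 1].
Definition half_disk : set 'rV[R]_2 := [set z | disk z /\ 0 <= z 0 0].
Definition diameter : set 'rV[R]_2 := [set z | disk z /\ z 0 0 = 0].

Definition cube (k : nat) : set 'rV[R]_k :=
  [set z | forall i, `|z 0 i| <= 1].

Definition flat_at_interior (d : nat) (Sigma : set 'rV[R]_d) (y : 'rV[R]_d) :
    Prop :=
  exists (N : set 'rV[R]_d) (phi : 'rV[R]_d -> 'rV[R]_2 * 'rV[R]_d.-2),
    [/\ nbhs y N,
        homeomorphism_on N (disk `*` @cube d.-2) phi &
        phi @` (N `&` Sigma) = disk `*` [set 0]].

Definition flat_at_boundary (d : nat) (Sigma : set 'rV[R]_d) (y : 'rV[R]_d) :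
    Prop :=
  exists (N : set 'rV[R]_d) (phi : 'rV[R]_d -> 'rV[R]_2 * 'rV[R]_d.-2),
    [/\ nbhs y N,
        homeomorphism_on N (disk `*` @cube d.-2) phi,
        phi @` (N `&` Sigma) = half_disk `*` [set 0] &
        (diameter `*` [set 0]) (phi y)].

End Topology.

Section Polygons.
Variables (R : realType) (d : nat).

Definition seg_point (a b : 'rV[R]_d) (t : R) : 'rV[R]_d :=
  (1 - t) *: a + t *: b.

Definition segment (a b : 'rV[R]_d) : set 'rV[R]_d :=
  [set seg_point a b t | t in `[0, 1]].

Variables (n : nat) (p : 'I_n -> 'rV[R]_d).

(* [ordS i] is the cyclic successor of [i], so the last edge closes the
   curve. *)
Definition polygon_edge (i : 'I_n) : set 'rV[R]_d := segment (p i) (p (ordS i)).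

Definition polygon : set 'rV[R]_d := \bigcup_i polygon_edge i.

(* Going once around, with each edge parametrized by [0, 1[, no point is met
   twice.  Consecutive collinear edges are allowed. *)
Definition closed_polygonal_curve : Prop :=
  (2 < n)%N /\
  forall (i j : 'I_n) (s t : R), s \in `[0, 1[ -> t \in `[0, 1[ ->
    seg_point (p i) (p (ordS i)) s = seg_point (p j) (p (ordS j)) t ->
    i = j /\ s = t.

End Polygons.

Section Disks.
Variable R : realType.

(* The simplex spanned by a set of vertices, in barycentric coordinates. *)
Definition simplex (m : nat) (s : {set 'I_m}) : set 'rV[R]_m :=
  [set x | [/\ forall i, 0 <= x 0 i, \sum_i x 0 i = 1 &
               forall i, i \notin s -> x 0 i = 0]].

Definition realization (m : nat) (T : {set {set 'I_m}}) : set 'rV[R]_m :=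
  \bigcup_(t in [set` T]) simplex t.

(* A finite two-dimensional simplicial complex, given by its triangles, with a
   parametrization of its geometric realization by the unit disk.  A vertex
   label in no triangle contributes nothing to the realization. *)
Record triangulated_disk (m : nat) := TriangulatedDisk {
  triangles : {set {set 'I_m}};
  card_triangle : forall t, t \in triangles -> #|t| = 3%N;
  param : 'rV[R]_2 -> 'rV[R]_m;
  paramP : homeomorphism_on (@disk R) (realization triangles) param
}.

Variables (m : nat) (S : triangulated_disk m).

Definition carrier : set 'rV[R]_m := realization (triangles S).

(* By invariance of the boundary this does not depend on [param]. *)
Definition boundary : set 'rV[R]_m := param S @` @circle R.

Definition boundary_edge (e : {set 'I_m}) : Prop :=
  [/\ #|e| = 2%N, exists2 t, t \in triangles S & e \subset t &
      simplex e `<=` boundary].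

Variables (d : nat) (f : 'rV[R]_m -> 'rV[R]_d).

Definition affine_on (A : set 'rV[R]_m) : Prop :=
  forall x y t, A x -> A y -> t \in `[0, 1] ->
    f (seg_point x y t) = seg_point (f x) (f y) t.

(* Only the values of [f] on [carrier] matter. *)
Definition immersed_PL_disk : Prop :=
  (forall t, t \in triangles S -> affine_on (simplex t) /\ set_inj (simplex t) f)
  /\ (forall x, carrier x ->
        exists2 U, nbhs x U & set_inj (U `&` carrier) f).

Definition complementary : Prop :=
  embedding_on boundary f /\
  f @` (carrier `\` boundary) `&` f @` boundary = set0.

Definition has_PL_boundary (n : nat) (p : 'I_n -> 'rV[R]_d) : Prop :=
  f @` boundary = polygon p /\
  [set f @` simplex e | e in boundary_edge] = range (polygon_edge p).

Definition locally_flat : Prop :=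
  forall x, carrier x ->
    exists U, [/\ nbhs x U, embedding_on (U `&` carrier) f,
      ~ boundary x -> flat_at_interior (f @` (U `&` carrier)) (f x) &
      boundary x -> flat_at_boundary (f @` (U `&` carrier)) (f x)].

End Disks.

(* Main.v *)
(* Proof idea.  Write the disk as an annulus of 2n triangles between the rim
   P_0, ..., P_(n-1) and an inner cycle Q_0, ..., Q_(n-1), together with the cone
   of the n edges of the inner cycle from a center C.  Map P_i to the vertex p_i
   of the polygon, and put all the Q_i and C in a single generic affine plane of
   R^4, as the vertices of a star-shaped planar polygon and an interior point.
   General position keeps the interior away from the polygon.  At a point of the
   open star of Q_i or C there is a linear projection R^4 -> R^2 under which the
   star becomes the planar model (P_j at twice Q_j), and at P_i one which unfolds
   the three triangles of its star onto a half plane.  So each sheet is locally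
   the graph of a continuous function over a disk or a half disk, and shearing
   along the fibres of the projection straightens it.  Inverses of the model
   map and of the projections are continuous by compactness. *)
From HB Require Import structures.
From mathcomp Require Import all_boot all_order all_algebra.
From mathcomp Require Import all_classical all_reals all_analysis.
From mathcomp Require Import ring lra.
Require Import Defs.
Set Implicit Arguments.
Unset Strict Implicit.
Unset Printing Implicit Defensive.

Import Order.TTheory GRing.Theory Num.Theory.
Import numFieldNormedType.Exports.

Local Open Scope classical_set_scope.
Local Open Scope ring_scope.

(** * Topological preliminaries *)

(** Dimension counts in R^4 shape the construction. A projection to R^2 that is prescribed on the
    plane of the [Q_j] and [C] is still free on two further vectors, and the annulus is cut along
    the diagonals [P_(i+1) Q_i] so that the star of [Q_i] contains exactly two vertices of the
    polygon, [P_i] and [P_(i+1)]. The link of [P_(i+1)] is the path [P_i, Q_i, Q_(i+1), P_(i+2)],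
    again four vectors; they are independent except when two consecutive edges are collinear, a
    degeneracy that no choice of the plane removes and that is treated apart. A triangle and an edge
    generically miss each other (2 + 1 < 4), but two triangles may meet in points (2 + 2 = 4); hence
    the disk is only immersed, and injectivity is proved on stars and on the rim. The plane is built
    from an origin [A] and directions [B1], [B2], chosen one after the other off finitely many
    proper affine subspaces. *)

Lemma homeomorphism_on_compact (X Y : topologicalType) (A : set X) (f : X -> Y) :
  hausdorff_space Y -> (exists x, A x) -> compact A -> {within A, continuous f} ->
  set_inj A f -> embedding_on A f.
Proof.
move=> hY [x0 Ax0] cA cf fI.
(* The inverse has to be a total function: off the image it takes the junk value [x0], whence the
   nonemptiness hypothesis. *)
have gP y : exists x, (f @` A) y -> A x /\ f x = y.
  case: (pselect ((f @` A) y)) => [[x Ax <-]|nAy]; last by exists x0.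
  by exists x.
pose g y := proj1_sig (cid (gP y)).
have gE y : (f @` A) y -> A (g y) /\ f (g y) = y by rewrite /g; case: cid.
exists g; split.
- split=> //; apply/continuous_closedP => F Fc.
  apply/closed_subspaceP; exists (f @` (A `&` F)).
    apply: compact_closed => //; apply: continuous_compact.
      by apply: (continuous_subspaceW _ cf) => x [].
    exact: compact_closedI.
  rewrite eqEsubset; split=> y [].
    move=> [x [Ax Fx] <-] fAx; split=> //.
    have [Ag fg] := gE _ fAx.
    suff e : g (f x) = x by change (F (g (f x))); rewrite e.
    by apply: fI; rewrite ?inE.
  move=> /= Fg fAy; split=> //.
  by have [Ag fg] := gE _ fAy; exists (g y).
- by move=> x Ax; exists x.
- by move=> y /gE [].
- move=> x /[!inE] Ax; have [|Ag fg] := gE (f x); first by exists x.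
  by apply: fI; rewrite ?inE.
- by move=> y /[!inE] /gE [].
Qed.

Lemma homeomorphism_on_inverse (X Y : topologicalType) (A : set X) (B : set Y)
    (f : X -> Y) :
  homeomorphism_on A B f -> exists g : Y -> X,
    [/\ homeomorphism_on B A g, {in A, cancel f g} & {in B, cancel g f}].
Proof.
move=> [g [[cf cg] fAB gBA fK gK]]; exists g; split=> //.
by exists f.
Qed.

Lemma cvg_mx (T : Type) (F : set_system T) (U : topologicalType) m n
    (f : T -> 'M[U]_(m, n)) (M : 'M[U]_(m, n)) :
  Filter F -> (forall i j, f x i j @[x --> F] --> M i j) -> f @ F --> M.
Proof.
move=> FF h A [P nP sPA].
have : \forall x \near F, forall i j, P i j (f x i j).
  by apply: filter_forall => i; apply: filter_forall => j; exact: h.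
by apply: filterS => x; exact: sPA.
Qed.

Lemma continuous_mx (T U : topologicalType) m n (f : T -> 'M[U]_(m, n)) :
  (forall i j, continuous (fun x => f x i j)) -> continuous f.
Proof. by move=> h x; apply: cvg_mx => i j; exact: h. Qed.

Lemma continuous_compT (T U V : topologicalType) (f : T -> U) (g : U -> V) :
  continuous f -> continuous g -> continuous (fun x => g (f x)).
Proof. by move=> cf cg x; exact: (continuous_comp (cf x) (cg (f x))). Qed.

Lemma continuous_pair (T U V : topologicalType) (f : T -> U) (g : T -> V) :
  continuous f -> continuous g -> continuous (fun x => (f x, g x)).
Proof.
move=> cf cg x.
exact: (@cvg_pair _ _ _ (nbhs x) (nbhs (f x)) (nbhs (g x)) _ _ _ f g (cf x) (cg x)).
Qed.

Section continuous_operations.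
Context {R : realType} {T : topologicalType}.

Lemma continuousDT (V : normedModType R) (f g : T -> V) :
  continuous f -> continuous g -> continuous (fun x => f x + g x).
Proof. by move=> cf cg x; exact: (cvgD (cf x) (cg x)). Qed.

Lemma continuousBT (V : normedModType R) (f g : T -> V) :
  continuous f -> continuous g -> continuous (fun x => f x - g x).
Proof. by move=> cf cg x; exact: (cvgB (cf x) (cg x)). Qed.

Lemma continuousNT (f : T -> R) :
  continuous f -> continuous (fun x => - f x).
Proof. by move=> cf x; exact: (cvgN (cf x)). Qed.

Lemma continuousZT (V : normedModType R) (k : R) (f : T -> V) :
  continuous f -> continuous (fun x => k *: f x).
Proof. by move=> cf x; exact: (cvgZl_tmp (cf x)). Qed.

Lemma continuousMT (f g : T -> R) :
  continuous f -> continuous g -> continuous (fun x => f x * g x).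
Proof. by move=> cf cg x; exact: (cvgM (cf x) (cg x)). Qed.

Lemma continuous_maxT (f g : T -> R) :
  continuous f -> continuous g -> continuous (fun x => Num.max (f x) (g x)).
Proof. by move=> cf cg x; exact: (continuous_max (cf x) (cg x)). Qed.

Lemma continuous_minT (f g : T -> R) :
  continuous f -> continuous g -> continuous (fun x => Num.min (f x) (g x)).
Proof. by move=> cf cg x; exact: (continuous_min (cf x) (cg x)). Qed.

Lemma continuous_normT (f : T -> R) :
  continuous f -> continuous (fun x => `|f x|).
Proof. by move=> cf x; exact: (cvg_norm (cf x)). Qed.

Lemma continuous_cstT (U : topologicalType) (a : U) : continuous (fun _ : T => a).
Proof. by move=> x; exact: cvg_cst. Qed.

Lemma continuous_coordT m n (f : T -> 'M[R]_(m, n)) i j :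
  continuous f -> continuous (fun x => f x i j).
Proof.
by move=> cf x; exact: (continuous_comp (cf x) (@coord_continuous _ _ _ i j (f x))).
Qed.

Lemma open_lt_continuous (f : T -> R) a : continuous f -> open [set x | f x < a].
Proof.
move=> cf; rewrite (_ : [set x | f x < a] = f @^-1` [set y | y < a]) //.
by move/continuousP: cf; apply; exact: open_lt.
Qed.

Lemma open_gt_continuous (f : T -> R) a : continuous f -> open [set x | a < f x].
Proof.
move=> cf; rewrite (_ : [set x | a < f x] = f @^-1` [set y | a < y]) //.
by move/continuousP: cf; apply; exact: open_gt.
Qed.

Lemma closed_ge_continuous (f : T -> R) a : continuous f -> closed [set x | a <= f x].
Proof.
move=> cf; rewrite (_ : [set x | a <= f x] = f @^-1` [set y | a <= y]) //.
by move/continuous_closedP: cf; apply; exact: closed_ge.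
Qed.

Lemma closed_eq_continuous (f : T -> R) a : continuous f -> closed [set x | f x = a].
Proof.
move=> cf; rewrite (_ : [set x | f x = a] = f @^-1` [set y | y = a]) //.
by move/continuous_closedP: cf; apply; exact: closed_eq.
Qed.

End continuous_operations.

Section continuous_matrix_operations.
Context {R : realType}.

Lemma continuous_sum (T : topologicalType) (I : Type) (r : seq I) (F : I -> T -> R) :
  (forall i, continuous (F i)) -> continuous (fun x => \sum_(i <- r) F i x).
Proof.
move=> h; elim: r => [|i r IH] x.
  under eq_fun do rewrite big_nil; exact: cvg_cst.
under eq_fun do rewrite big_cons.
by apply: (@cvgD _ R); [exact: h|exact: IH].
Qed.

Lemma continuous_mulmxl m n p (B : 'M[R]_(n, p)) :
  continuous (fun A : 'M[R]_(m, n) => A *m B).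
Proof.
apply: continuous_mx => i k; under eq_fun do rewrite mxE.
apply: continuous_sum => j x.
by apply: (@cvgM _ _ (nbhs x)); [exact: coord_continuous|exact: cvg_cst].
Qed.

Lemma continuous_row_mx (T : topologicalType) m n1 n2
    (f : T -> 'M[R]_(m, n1)) (g : T -> 'M[R]_(m, n2)) :
  continuous f -> continuous g -> continuous (fun x => row_mx (f x) (g x)).
Proof.
move=> cf cg; apply: continuous_mx => i j.
have [k ->|k ->] := split_ordP j.
  under eq_fun do rewrite row_mxEl.
  move=> x; exact: (continuous_comp (cf x) (@coord_continuous _ _ _ i k (f x))).
under eq_fun do rewrite row_mxEr.
move=> x; exact: (continuous_comp (cg x) (@coord_continuous _ _ _ i k (g x))).
Qed.

End continuous_matrix_operations.

(** * Local flatness from a linear projection *)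

Section local_flatness.
Context {R : realType}.

(** Gaussian elimination factors [X] through an invertible [C], the columns of [X] spanning the
    first two columns of [C]; the last two columns of [C] complete them. *)
Lemma rank2_complement (X : 'M[R]_(4, 2)) : \rank X = 2%N ->
  exists X' : 'M[R]_(4, 2), (row_mx X X' : 'M[R]_(4, 2 + 2)) \in unitmx.
Proof.
move=> rX; pose C : 'M[R]_(2 + 2) := col_ebase X.
have CU : C \in unitmx by apply: col_ebase_unit.
exists (rsubmx C).
have -> : (row_mx X (rsubmx C) : 'M[R]_(2 + 2)) = C *m block_mx (row_ebase X) 0 0 1%:M.
  rewrite -[C in RHS]hsubmxK mul_row_block !mulmx0 add0r addr0 mulmx1.
  congr row_mx; rewrite -[LHS](mulmx_ebase X) rX -/C.
  congr (_ *m _); change (C *m (pid_mx 2 : 'M[R]_(2 + 2, 2)) = lsubmx C).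
  by rewrite pid_mx_col -[C in LHS]hsubmxK mul_row_col mulmx1 mulmx0 addr0.
rewrite unitmx_mul CU (@unitmxE _ (2 + 2)) det_ublock det1 mulr1 -unitmxE.
exact: row_ebase_unit.
Qed.

Lemma nbhs_disk : nbhs (0 : 'rV[R]_2) (@disk R).
Proof.
exists (fun _ _ => ball (0 : R) 2^-1) => [i j|z h].
  by rewrite mxE; apply: nbhsx_ballx; rewrite invr_gt0.
rewrite /disk /= big_ord_recl big_ord1.
have := h ord0 0; have := h ord0 (lift ord0 0); rewrite /ball /= !sub0r !normrN.
move=> /ltr_normlP [a1 a2] /ltr_normlP [b1 b2]; nra.
Qed.

Lemma nbhs_cube k : nbhs (0 : 'rV[R]_k) (@cube R k).
Proof.
exists (fun _ _ => ball (0 : R) 1) => [i j|z h i].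
  by rewrite mxE; apply: nbhsx_ballx.
by have := h ord0 i; rewrite /ball /= !sub0r !normrN; exact: ltW.
Qed.

(* The chart [y |-> (y X, (y - s (y X)) X')] straightens the graph of the
   section [s] of the projection [X]. *)
Lemma graph_chart (Sigma : set 'rV[R]_4) (X : 'M[R]_(4, 2)) (c : 'rV[R]_2)
    (e : R) (s : 'rV[R]_2 -> 'rV[R]_4) (D : set 'rV[R]_2) :
  \rank X = 2%N -> 0 < e -> continuous s -> s c *m X = c ->
  (forall z, D z -> [/\ disk z, Sigma (s (c + e *: z)) &
    s (c + e *: z) *m X = c + e *: z]) ->
  (forall y, Sigma y -> disk (e^-1 *: (y *m X - c)) ->
    D (e^-1 *: (y *m X - c)) /\ s (y *m X) = y) ->
  exists (N : set 'rV[R]_4) (phi : 'rV[R]_4 -> 'rV[R]_2 * 'rV[R]_4.-2),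
    [/\ nbhs (s c) N, homeomorphism_on N (@disk R `*` @cube R 4.-2) phi,
      phi @` (N `&` Sigma) = D `*` [set 0] & phi (s c) = (0, 0)].
Proof.
move=> rX e0 cs sc hD hS.
have [X' XU] := rank2_complement rX.
have eN0 : e != 0 by rewrite gt_eqF.
pose J := invmx (row_mx X X' : 'M[R]_(2 + 2)).
pose phi (y : 'rV[R]_4) : 'rV[R]_2 * 'rV[R]_2 :=
  (e^-1 *: (y *m X - c), (y - s (y *m X)) *m X').
pose psi (q : 'rV[R]_2 * 'rV[R]_2) : 'rV[R]_4 :=
  row_mx (c + e *: q.1) (q.2 + s (c + e *: q.1) *m X') *m J.
have JX (z u : 'rV[R]_2) : (row_mx z u *m J) *m X = z /\ (row_mx z u *m J) *m X' = u.
  apply: eq_row_mx; rewrite -mul_mx_row -mulmxA /J mulVmx ?mulmx1 //.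
have cE z : c + e *: (e^-1 *: (z - c)) = z.
  by rewrite scalerA divff // scale1r addrC subrK.
have phiK : cancel phi psi.
  move=> y; rewrite /psi /phi /= cE mulmxBl subrK -mul_mx_row -mulmxA.
  by rewrite /J mulmxV ?mulmx1.
have psiK : cancel psi phi.
  move=> [z u]; rewrite /phi /psi /= mulmxBl.
  have [-> ->] := JX (c + e *: z) (u + s (c + e *: z) *m X').
  by rewrite addrC addKr scalerA mulVf // scale1r addrK.
have cX k (T : 'M[R]_(4, k)) : continuous (fun y : 'rV[R]_4 => y *m T).
  exact: continuous_mulmxl.
have csub : continuous (fun y : 'rV[R]_4 => y - s (y *m X)).
  apply: continuousBT => [y|]; first exact: cvg_id.
  exact: (continuous_compT (cX _ X) cs).
have cphi : continuous phi.
  apply: continuous_pair; last exact: (continuous_compT csub (cX _ X')).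
  by apply: continuousZT; apply: continuousBT; [exact: cX|exact: continuous_cstT].
have caff : continuous (fun q : 'rV[R]_2 * 'rV[R]_2 => c + e *: q.1).
  apply: continuousDT; first exact: continuous_cstT.
  by apply: continuousZT => q; exact: cvg_fst.
have crow : continuous (fun q : 'rV[R]_2 * 'rV[R]_2 =>
    row_mx (c + e *: q.1) (q.2 + s (c + e *: q.1) *m X')).
  apply: (continuous_row_mx caff).
  apply: continuousDT => [q|]; first exact: cvg_snd.
  exact: (continuous_compT (continuous_compT caff cs) (cX _ X')).
have cpsi : continuous psi.
  exact: (continuous_compT crow (@continuous_mulmxl _ _ _ _ J)).
have phisc : phi (s c) = (0, 0).
  by rewrite /phi sc !subrr scaler0 mul0mx.
pose B := (@disk R `*` @cube R 2).
exists (phi @^-1` B), phi; split=> //.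
- apply: cphi; rewrite phisc; exists (@disk R, @cube R 2) => //=.
  by split; [exact: nbhs_disk|exact: nbhs_cube].
- exists psi; split.
  + by split; apply: continuous_subspaceT.
  + by [].
  + by move=> q Bq; rewrite /preimage /= psiK.
  + by move=> y _; exact: phiK.
  + by move=> q _; exact: psiK.
- rewrite eqEsubset; split=> [_ [y [[dy _] Sy] <-]|[z u] /= [Dz ->]].
    by have [Dy sy] := hS _ Sy dy; split=> //=; rewrite sy subrr mul0mx.
  have [dz Sz sX] := hD _ Dz.
  have phiE : phi (s (c + e *: z)) = (z, 0).
    by rewrite /phi sX subrr mul0mx addrC addKr scalerA mulVf // scale1r.
  exists (s (c + e *: z)) => //; split=> //.
  by rewrite /preimage /= phiE; split=> //=; exact: (nbhs_singleton (nbhs_cube 2)).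
Qed.

(** Compactness gives a continuous inverse of the projection on the image of [Sigma] only, while a
    graph chart asks for a section on the whole plane. The inverse is therefore precomposed with a
    retraction [r] onto a box, or a half box if [H] holds, inside the image. *)
Lemma compact_graph_chart (Sigma : set 'rV[R]_4) (X : 'M[R]_(4, 2))
    (y0 : 'rV[R]_4) (H : bool) (c : 'rV[R]_2) :
  y0 *m X = c -> \rank X = 2%N -> compact Sigma -> Sigma y0 -> set_inj Sigma (mulmx^~ X) ->
  nbhs c [set z : 'rV[R]_2 | (H -> c 0 0 <= z 0 0) ->
    exists2 y, Sigma y & y *m X = z] ->
  (H -> forall y, Sigma y -> c 0 0 <= (y *m X) 0 0) ->
  exists (N : set 'rV[R]_4) (phi : 'rV[R]_4 -> 'rV[R]_2 * 'rV[R]_4.-2),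
    [/\ nbhs y0 N, homeomorphism_on N (@disk R `*` @cube R 4.-2) phi,
      phi @` (N `&` Sigma) = (if H then @half_disk R else @disk R) `*` [set 0] &
      phi y0 = (0, 0)].
Proof.
move=> y0c rX cS Sy0 piI /nbhs_ballP [e2 /= e20 hsurj] hH.
pose pi := fun y : 'rV[R]_4 => y *m X.
pose e := e2 / 2.
have e0 : 0 < e by rewrite divr_gt0.
have ee2 : e < e2 by rewrite /e; lra.
have piC : continuous pi by exact: continuous_mulmxl.
have [g [[_ cg] _ _ gK piK]] : embedding_on Sigma pi.
  apply: homeomorphism_on_compact => //; first by exists y0.
  exact: continuous_subspaceT.
have boxP (z : 'rV[R]_2) : (forall k, `|z 0 k - c 0 k| <= e) -> (H -> c 0 0 <= z 0 0) ->
    (pi @` Sigma) z.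
  move=> hz hz0; have [|y Sy yz] := hsurj z _ hz0; last by exists y.
  split=> // i k; rewrite ord1 /ball /= distrC.
  exact: le_lt_trans (hz k) ee2.
(* Lower sides of the box: in the boundary case its first coordinate starts at [c] itself. *)
pose lo (k : 'I_2) := if H && (k == 0) then c 0 k else c 0 k - e.
pose r (z : 'rV[R]_2) : 'rV[R]_2 :=
  \row_k Num.max (lo k) (Num.min (c 0 k + e) (z 0 k)).
have loc k : lo k <= c 0 k by rewrite /lo; case: ifP => // _; lra.
have loe k : c 0 k - e <= lo k by rewrite /lo; case: ifP => // _; lra.
have rS z : (pi @` Sigma) (r z).
  apply: boxP => [k|hH'].
    have := loc k; have := loe k; rewrite mxE.
    by case: (leP (c 0 k + e) (z 0 k)) => ?;
      [case: (leP (lo k) (c 0 k + e))|case: (leP (lo k) (z 0 k))] => ? ? ?;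
      rewrite ler_norml; apply/andP; split; lra.
  by rewrite mxE /lo hH' eqxx /= le_max lexx.
have rid (z : 'rV[R]_2) : (forall k, `|z 0 k - c 0 k| <= e) -> (H -> c 0 0 <= z 0 0) -> r z = z.
  move=> hz hz0; apply/rowP => k; rewrite mxE.
  have : lo k <= z 0 k.
    rewrite /lo; case: ifP => [/andP[/hz0 h /eqP ->] //|_].
    by have := hz k; rewrite ler_norml => /andP[h1 h2]; lra.
  have := hz k; rewrite ler_norml => /andP[h1 h2] ?.
  by rewrite min_r ?max_r //; lra.
have cr : continuous r.
  apply: continuous_mx => i k; under eq_fun do rewrite mxE.
  apply: continuous_maxT; first exact: continuous_cstT.
  apply: continuous_minT; first exact: continuous_cstT.
  by apply: continuous_coordT => x; exact: cvg_id.
have cs : continuous (g \o r).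
  (* [g] is continuous only relative to the image, which suffices because [r] takes all its values
     there. *)
  move=> z; have /subspace_continuousP /(_ _ (rS z)) cgz := cg.
  move=> A /cgz /= wA; have := cr z _ wA; apply: (@filterS _ (nbhs z)) => u h.
  exact/h/rS.
have rc : r c = c.
  by apply: rid => // k; rewrite subrr normr0 ltW.
have src : (g \o r) c = y0 by rewrite /= rc -y0c (gK y0) ?inE.
(* The Euclidean disk of radius [e] lies in the box of half side [e], where [r] fixes the points
   that also satisfy the half-plane condition. *)
have small (z : 'rV[R]_2) : disk (e^-1 *: (z - c)) -> forall k, `|z 0 k - c 0 k| <= e.
  move=> dz k.
  have h : (e^-1 *: (z - c)) 0 k ^+ 2 <= 1.
    apply: le_trans dz; rewrite (bigD1 k) //= lerDl.
    by apply: sumr_ge0 => j _; exact: sqr_ge0.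
  have : `|(e^-1 *: (z - c)) 0 k| <= 1 by rewrite -(@expr_le1 _ 2%N) // real_normK ?num_real.
  rewrite !mxE normrM gtr0_norm ?invr_gt0 // mulrC ler_pdivrMr // mul1r.
  by [].
have half (z : 'rV[R]_2) : H -> (0 <= (e^-1 *: (z - c)) 0 0) = (c 0 0 <= z 0 0).
  by move=> _; rewrite !mxE pmulr_rge0 ?invr_gt0 // subr_ge0.
have scE (z : 'rV[R]_2) : c + e *: z - c = e *: z by rewrite addrC addKr.
have eK (z : 'rV[R]_2) : e^-1 *: (c + e *: z - c) = z :> 'rV[R]_2.
  by rewrite scE scalerA mulVf ?scale1r // gt_eqF.
have := @graph_chart Sigma X c e (g \o r) (if H then @half_disk R else @disk R).
rewrite src; apply=> //.
- move=> z Dz; have dz : disk z by move: Dz; case: (H) => // -[].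
  have rz : r (c + e *: z) = c + e *: z.
    apply: rid; first by apply: small; rewrite eK.
    by move=> hH'; rewrite -half // eK; move: Dz; rewrite hH' => -[].
  have [y Sy yE] := rS (c + e *: z).
  by rewrite /= -yE gK ?inE //; split=> //; rewrite -[RHS]rz -yE.
- move=> y Sy dy; have sm := small _ dy.
  have hy : H -> c 0 0 <= (y *m X) 0 0 by move=> /hH; apply.
  split; last by rewrite /= rid // -/(pi y) gK ?inE.
  case: (H) hy (half (y *m X)) => // hy hh.
  by split=> //; rewrite hh // hy.
Qed.

Lemma flat_at_interior_projection (Sigma : set 'rV[R]_4) (X : 'M[R]_(4, 2)) (y0 : 'rV[R]_4) :
  \rank X = 2%N -> compact Sigma -> Sigma y0 -> set_inj Sigma (mulmx^~ X) ->
  nbhs (y0 *m X) [set z | exists2 y, Sigma y & y *m X = z] ->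
  flat_at_interior Sigma y0.
Proof.
move=> rX cS Sy0 piI hs.
have [||N [phi [? ? ? ?]]] := @compact_graph_chart Sigma X y0 false _ erefl rX cS Sy0 piI.
- by apply: filterS hs => z hz _; exact: hz.
- by [].
by exists N, phi.
Qed.

Lemma flat_at_boundary_projection (Sigma : set 'rV[R]_4) (X : 'M[R]_(4, 2)) (y0 : 'rV[R]_4) :
  \rank X = 2%N -> compact Sigma -> Sigma y0 -> set_inj Sigma (mulmx^~ X) ->
  (forall y, Sigma y -> (y0 *m X) 0 0 <= (y *m X) 0 0) ->
  nbhs (y0 *m X) [set z : 'rV[R]_2 | (y0 *m X) 0 0 <= z 0 0 ->
    exists2 y, Sigma y & y *m X = z] ->
  flat_at_boundary Sigma y0.
Proof.
move=> rX cS Sy0 piI hH hs.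
have [||N [phi [? ? ? e0]]] := @compact_graph_chart Sigma X y0 true _ erefl rX cS Sy0 piI.
- by apply: filterS hs => z hz h; exact/hz/h.
- by move=> _.
exists N, phi; split=> //; rewrite e0; split=> //; split; last by rewrite mxE.
exact: (nbhs_singleton nbhs_disk).
Qed.

End local_flatness.

(** * The planar fan *)

Lemma cramer2 (F : fieldType) (x y x' y' a b c d : F) : x * y' - x' * y != 0 ->
  a * x + b * x' = c * x + d * x' -> a * y + b * y' = c * y + d * y' ->
  a = c /\ b = d.
Proof.
move=> D /eqP; rewrite -subr_eq0 => /eqP EX /eqP; rewrite -subr_eq0 => /eqP EY.
split; apply: (mulIf D); apply/eqP; rewrite -subr_eq0; apply/eqP.
  transitivity ((a * x + b * x' - (c * x + d * x')) * y' -
    (a * y + b * y' - (c * y + d * y')) * x'); first by ring.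
  by rewrite EX EY !mul0r subrr.
transitivity ((a * y + b * y' - (c * y + d * y')) * x -
  (a * x + b * x' - (c * x + d * x')) * y); first by ring.
by rewrite EX EY !mul0r subrr.
Qed.

Section planar_fan.
Context {R : realType} {n : nat} (n_gt2 : (2 < n)%N).

Lemma rV2P (u v : 'rV[R]_2) : u 0 0 = v 0 0 -> u 0 1 = v 0 1 -> u = v.
Proof.
move=> h0 h1; apply/rowP => k; rewrite -[0]/(ord0).
by have [->|->] : k = 0 \/ k = 1 by case: k => [[|[|k]]] // hk; [left|right]; exact: val_inj.
Qed.

(* The ray [0] points down and the rays [1, ..., n-1] meet the line [y = 1] at
   unit distance from each other, symmetrically about the vertical axis. *)
Definition ray_x (k : nat) : R := if k == 0%N then 0 else k%:R - n%:R / 2.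
Definition ray_y (k : nat) : R := if k == 0%N then -1 else 1.
Definition ray (k : 'I_n) : 'rV[R]_2 :=
  \row_j if j == 0 then ray_x k else ray_y k.

Definition ray_pair (i : 'I_n) (a b : R) : 'rV[R]_2 :=
  a *: ray i + b *: ray (ordS i).

Definition half_width : R := n%:R / 2 - 1.

(* The Minkowski functional of the triangle with vertices at the rays [0], [1]
   and [n - 1], on whose boundary all the rays lie. *)
Definition gauge (z : 'rV[R]_2) : R :=
  Num.max (z 0 1) (2 * `|z 0 0| / half_width - z 0 1).

Lemma half_width_gt0 : 0 < half_width.
Proof.
have : 3 <= n%:R :> R by rewrite (ler_nat _ 3).
by rewrite /half_width; lra.
Qed.
Let hw0 := half_width_gt0.

(** The three kinds of sector between neighbouring rays: from the downward ray to the left end of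
    the top side, between two rays of the top side, and from the right end back to the downward
    ray. *)
Variant ordS_spec : nat -> nat -> Prop :=
| OrdSFirst : ordS_spec 0 1
| OrdSMiddle k of (0 < k)%N & (k.+1 < n)%N : ordS_spec k k.+1
| OrdSLast : ordS_spec n.-1 0.

Lemma ordSP (i : 'I_n) : ordS_spec i (ordS i).
Proof.
case: i => k kn; rewrite /=.
have [->|k0] := eqVneq k 0%N.
  by rewrite modn_small ?(ltn_trans _ n_gt2) //; constructor.
have [kn1|] := ltnP k.+1 n.
  by rewrite modn_small //; constructor; rewrite ?lt0n.
move=> nk; have -> : k.+1 = n by apply/eqP; rewrite eqn_leq kn nk.
rewrite modnn (_ : k = n.-1); first by constructor.
by apply/eqP; rewrite -eqSS prednK ?(ltn_trans _ n_gt2) // eqn_leq kn nk.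
Qed.

Lemma ray_pairE i a b :
  (ray_pair i a b 0 0 = a * ray_x i + b * ray_x (ordS i)) *
  (ray_pair i a b 0 1 = a * ray_y i + b * ray_y (ordS i)).
Proof. by rewrite !mxE. Qed.

Lemma ray_x_pred : ray_x n.-1 = half_width.
Proof.
rewrite /ray_x /half_width; case: n n_gt2 => [|[|m]] //= _.
by rewrite -[in RHS](natr1 m.+1); lra.
Qed.

Lemma ray_x1 : ray_x 1 = - half_width.
Proof. by rewrite /ray_x /half_width /=; lra. Qed.

Lemma ray_y_pred : ray_y n.-1 = 1.
Proof. by rewrite /ray_y; case: n n_gt2 => [|[|m]]. Qed.

Lemma ray_y_neq0 (i : 'I_n) : ray_y i != 0.
Proof. by rewrite /ray_y; case: ifP => _; rewrite ?oppr_eq0 oner_eq0. Qed.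

Lemma ray_det_neq0 (i : 'I_n) :
  ray_x i * ray_y (ordS i) - ray_x (ordS i) * ray_y i != 0.
Proof.
have h := hw0.
case: ordSP => [|k k0 kn|].
- by rewrite ray_x1 /ray_x /ray_y /=; lra.
- by rewrite /ray_x /ray_y -natr1 (gtn_eqF k0) /=; lra.
- by rewrite ray_x_pred ray_y_pred /ray_x /ray_y /=; lra.
Qed.

Lemma ler_nat1 k : (0 < k)%N -> 1 <= k%:R :> R.
Proof. by rewrite (ler_nat _ 1). Qed.

(** Neighbouring rays end on a common side of the triangle, and the gauge is linear on the cone over
    a side, with value 1 on that side. *)
Lemma gauge_ray_pair i a b : 0 <= a -> 0 <= b -> gauge (ray_pair i a b) = a + b.
Proof.
move=> a0 b0; have h := hw0; have hN0 : half_width != 0 by rewrite gt_eqF.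
rewrite /gauge !ray_pairE; case: ordSP => [|k k0 kn|].
- rewrite ray_x1 /ray_x /ray_y /= mulr0 add0r normrM normrN.
  rewrite (ger0_norm b0) (gtr0_norm h) mulrA mulfK //.
  by rewrite max_r; lra.
- have k1 := ler_nat1 k0.
  have k2 : k%:R + 2 <= n%:R :> R by rewrite -natrD ler_nat addn2.
  rewrite /ray_x /ray_y (gtn_eqF k0) /= -(natr1 k) !mulr1 max_l //.
  suff : 2 * `|a * (k%:R - n%:R / 2) + b * (k%:R + 1 - n%:R / 2)| / half_width
    <= 2 * (a + b) by lra.
  rewrite ler_pdivrMr // -mulrA ler_pM2l // ler_norml.
  (* The bounds [1 <= k] and [k + 2 <= n], weighted by the coefficients, are the products from which
     [nra] bounds the abscissa. *)
  have ha1 : 0 <= a * (k%:R - 1) by rewrite mulr_ge0 // subr_ge0.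
  have hb1 : 0 <= b * (k%:R - 1) by rewrite mulr_ge0 // subr_ge0.
  have ha2 : 0 <= a * (n%:R - k%:R - 2) by rewrite mulr_ge0 //; lra.
  have hb2 : 0 <= b * (n%:R - k%:R - 2) by rewrite mulr_ge0 //; lra.
  rewrite /half_width; apply/andP; split; nra.
- rewrite ray_x_pred ray_y_pred /ray_x /ray_y /= mulr0 addr0 normrM.
  rewrite (ger0_norm a0) (gtr0_norm h) mulrA mulfK //.
  by rewrite max_r; lra.
Qed.

Lemma ray_pair_surj z : exists i a b,
  [/\ 0 <= a, 0 <= b & z = ray_pair i a b].
Proof.
have h := hw0; have hN0 : half_width != 0 by rewrite gt_eqF.
have n0 : (0 < n)%N by apply: ltn_trans n_gt2.
set X := z 0 0; set Y := z 0 1.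
(* The sector of the rays 0 and 1: the coefficients solve [X = - b * half_width] and [Y = b - a],
   and the two inequalities are their signs. *)
have [/andP[c1 c2]|c] := boolP ((X <= 0) && (X + half_width * Y <= 0)).
  exists (Ordinal n0), (- X / half_width - Y), (- X / half_width).
  split; first by rewrite subr_ge0 ler_pdivlMr //; lra.
    by rewrite divr_ge0 //; lra.
  have iS : ordS (Ordinal n0) = 1%N :> nat.
    by rewrite /= modn_small // (ltn_trans _ n_gt2).
  by apply: rV2P; rewrite !ray_pairE iS /= ?ray_x1 /ray_x /ray_y /= -/X -/Y; field.
have [/andP[d1 d2]|d] := boolP ((0 <= X) && (half_width * Y <= X)).
  have nn : (n.-1 < n)%N by rewrite prednK.
  exists (Ordinal nn), (X / half_width), (X / half_width - Y).
  split; first by rewrite divr_ge0 //; lra.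
    by rewrite subr_ge0 ler_pdivlMr //; lra.
  have iS : ordS (Ordinal nn) = 0%N :> nat by rewrite /= prednK // modnn.
  apply: rV2P; rewrite !ray_pairE iS /= ?ray_x_pred ?ray_y_pred /ray_x /ray_y /= -/X -/Y; field.
    by [].
  by [].
have Y0 : 0 < Y.
  rewrite ltNge; apply/negP => Y0; have := mulr_ge0_le0 (ltW h) Y0 => hY.
  move: c d; rewrite !negb_and -!ltNge.
  by case: (lerP X 0) => /= ? ?; case: (lerP 0 X) => /= ?; nra.
have [X1 X2] : - half_width * Y < X /\ X < half_width * Y.
  have hY := mulr_gt0 h Y0; move: c d; rewrite !negb_and -!ltNge.
  case: (lerP X 0) => /= ? ?; case: (lerP 0 X) => /= ?; split; lra.
(* In the remaining cone over the top side, the least [m] whose ray passes strictly to the right of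
   [z] determines the sector, between the rays [m - 1] and [m]. *)
pose P m := X < (m%:R - n%:R / 2) * Y.
have Pn : P n.-1.
  rewrite /P -[_ - _]/(n.-1%:R - n%:R / 2) (_ : _ - _ = half_width) //.
  by rewrite -ray_x_pred /ray_x; case: n n_gt2 => [|[|m]].
have exP : exists m, P m by exists n.-1.
case: (ex_minnP exP) => m Pm mP.
have mn : (m <= n.-1)%N := mP _ Pn.
have [m0|m1] := leqP m 1.
  suff : X < - half_width * Y by lra.
  apply: lt_le_trans Pm _; rewrite ler_pM2r // /half_width.
  by have : m%:R <= 1 :> R; [rewrite (ler_nat _ _ 1)|lra].
have {}Pm' : (m.-1%:R - n%:R / 2) * Y <= X.
  by rewrite leNgt; apply/negP => /mP; rewrite -ltnS prednK ?ltnn // ltnW.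
case: m m1 mn Pm Pm' {mP} => // m m1 mn /= Pm Pm'.
have mn' : (m.+1 < n)%N by rewrite -[n]prednK.
have iS : ordS (Ordinal (ltnW mn')) = m.+1 :> nat by rewrite /= modn_small.
exists (Ordinal (ltnW mn')), ((m.+1%:R - n%:R / 2) * Y - X), (X - (m%:R - n%:R / 2) * Y).
split; [by rewrite subr_ge0 ltW|by rewrite subr_ge0|].
apply: rV2P; rewrite !ray_pairE iS /= /ray_x /ray_y /= (gtn_eqF (_ : 0 < m)%N) // -/X -/Y -(natr1 m);
  by field.
Qed.

(** A point on a ray common to two sectors has two descriptions [(i, a, b)]; the coefficient viewed
    as a function of the ray is the same for both. *)
Definition pair_coef (i : 'I_n) (a b : R) (k : 'I_n) : R :=
  a * (k == i)%:R + b * (k == ordS i)%:R.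

(** Within one sector this is the independence of neighbouring rays; two different sectors share at
    most a ray, on which the coefficients agree. *)
Lemma ray_pair_inj i j a b c d : 0 <= a -> 0 <= b -> 0 <= c -> 0 <= d ->
  ray_pair i a b = ray_pair j c d -> pair_coef i a b =1 pair_coef j c d.
Proof.
wlog ij : i j a b c d / (i <= j)%N.
  move=> H a0 b0 c0 d0 E.
  have [h|/ltnW h] := leqP i j; first exact: (H _ _ _ _ _ _ h a0 b0 c0 d0 E).
  by move=> k; rewrite (H _ _ _ _ _ _ h c0 d0 a0 b0 (esym E)).
move=> a0 b0 c0 d0 E.
have EX := congr1 (fun z : 'rV[R]_2 => z 0 0) E.
have EY := congr1 (fun z : 'rV[R]_2 => z 0 1) E.
rewrite /= !ray_pairE in EX EY.
have h := hw0.
have [eij|nij] := eqVneq i j.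
  have [] : a = c /\ b = d; last by move=> -> ->; rewrite eij.
  rewrite -eij in EX EY; exact: cramer2 (ray_det_neq0 i) EX EY.
have {nij} ij' : (i < j)%N by rewrite ltn_neqAle ij andbT; apply: contra nij => /eqP/val_inj ->.
(* For [i < j] the point is the origin, or lies on the ray where sector [i] ends and [j] begins, or
   on the ray 0, where the last sector closes up with the first. *)
suff [[-> -> -> [->|e]]|[-> -> -> e]] :
    [/\ a = 0, d = 0, b = c & b = 0 \/ ordS i = j :> nat] \/
    [/\ b = 0, c = 0, a = d & i = ordS j :> nat].
- by move=> k; rewrite /pair_coef !mul0r.
- by move=> k; rewrite /pair_coef !mul0r (val_inj e) addrC.
- by move=> k; rewrite /pair_coef !mul0r (val_inj e) addrC.
move: ij' EX EY; case: (ordSP i) => [|k k0 kn|]; case: (ordSP j) => [|l l0 ln|] //.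
- move=> _; rewrite ray_x1 /ray_x /ray_y (gtn_eqF l0) /= -(natr1 l) /half_width => EX EY.
  have l1 := ler_nat1 l0.
  have cl : 0 <= c * (l%:R - 1) by rewrite mulr_ge0 // subr_ge0.
  have dl : 0 <= d * (l%:R - 1) by rewrite mulr_ge0 // subr_ge0.
  have ha := mulr_ge0 a0 (ltW h); rewrite /half_width in ha h.
  have d00 : d = 0 by nra.
  have a00 : a = 0 by nra.
  left; split=> //; first by lra.
  have [->|l2] := eqVneq l 1%N; first by right.
  left; have : 2 <= l%:R :> R by rewrite (ler_nat _ 2) ltn_neqAle eq_sym l2.
  by move=> ?; nra.
- move=> _; rewrite ray_x1 ray_x_pred ray_y_pred /ray_x /ray_y /= => EX EY.
  have b00 : b = 0 by nra.
  have c00 : c = 0 by nra.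
  by right; split=> //; lra.
- move=> kl; rewrite /ray_x /ray_y (gtn_eqF l0) (gtn_eqF k0) /= -(natr1 l) -(natr1 k) => EX EY.
  have kl' : k%:R + 1 <= l%:R :> R by rewrite natr1 ler_nat.
  have ha : 0 <= a * (l%:R - k%:R - 1) by rewrite mulr_ge0 //; lra.
  have hb : 0 <= b * (l%:R - k%:R - 1) by rewrite mulr_ge0 //; lra.
  have d00 : d = 0 by nra.
  have a00 : a = 0 by nra.
  left; split=> //; first by lra.
  have [->|k2] := eqVneq k.+1 l; first by right.
  left; have : k%:R + 2 <= l%:R :> R by rewrite -natrD ler_nat addn2 ltn_neqAle k2.
  by move=> ?; nra.
- move=> _; rewrite ray_x_pred ray_y_pred /ray_x /ray_y (gtn_eqF k0) /= -(natr1 k) /half_width => EX EY.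
  have kl' : k%:R + 2 <= n%:R :> R by rewrite -natrD ler_nat addn2.
  have ha : 0 <= a * (n%:R - k%:R - 2) by rewrite mulr_ge0 //; lra.
  have hb : 0 <= b * (n%:R - k%:R - 2) by rewrite mulr_ge0 //; lra.
  have hd := mulr_ge0 d0 (ltW h); rewrite /half_width in hd h.
  have d00 : d = 0 by nra.
  have a00 : a = 0 by nra.
  left; split=> //; first by lra.
  have [->|k2] := eqVneq k.+1 n.-1; first by right.
  left; have : k%:R + 3 <= n%:R :> R.
    rewrite -natrD ler_nat addn3 ltn_neqAle kn andbT.
    by apply: contra k2 => /eqP <-.
  by move=> ?; nra.
- by move=> /(leq_trans (leqSpred n)); rewrite leqNgt (ltnW ln).
- by rewrite ltnn.
Qed.

Lemma gauge_ge0 z : 0 <= gauge z.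
Proof.
have [i [a [b [a0 b0 ->]]]] := ray_pair_surj z.
by rewrite gauge_ray_pair // addr_ge0.
Qed.

Lemma gauge_eq0 z : gauge z = 0 -> z = 0.
Proof.
have [i [a [b [a0 b0 ->]]]] := ray_pair_surj z.
rewrite gauge_ray_pair // => ab; have [-> ->] : a = 0 /\ b = 0 by split; lra.
by rewrite /ray_pair !scale0r addr0.
Qed.

Lemma gaugeZ t z : 0 <= t -> gauge (t *: z) = t * gauge z.
Proof.
have [i [a [b [a0 b0 ->]]]] := ray_pair_surj z => t0.
have -> : t *: ray_pair i a b = ray_pair i (t * a) (t * b).
  by rewrite /ray_pair scalerDr !scalerA.
by rewrite !gauge_ray_pair ?mulr_ge0 // mulrDr.
Qed.

Lemma gauge0 : gauge 0 = 0.
Proof. by rewrite -(scale0r (0 : 'rV[R]_2)) gaugeZ // mul0r. Qed.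

Lemma continuous_gauge : continuous gauge.
Proof.
have cc k : continuous (fun z : 'rV[R]_2 => z 0 k).
  by apply: continuous_coordT => x; exact: cvg_id.
apply: continuous_maxT; first exact: cc.
apply: continuousBT; last exact: cc.
apply: continuousMT; last exact: continuous_cstT.
apply: continuousMT; first exact: continuous_cstT.
exact: continuous_normT.
Qed.

(** * The radial homeomorphism from the triangle onto the round disk *)

Definition sqnorm (z : 'rV[R]_2) : R := \sum_i z 0 i ^+ 2.

Lemma sqnorm_ge0 z : 0 <= sqnorm z.
Proof. by apply: sumr_ge0 => i _; exact: sqr_ge0. Qed.

Lemma sqnorm_gt0 z : z != 0 -> 0 < sqnorm z.
Proof.
move=> z0; rewrite lt_neqAle sqnorm_ge0 andbT eq_sym; apply: contra z0.
rewrite psumr_eq0 => [/allP h|i _]; last exact: sqr_ge0.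
apply/eqP/rowP => i; rewrite mxE; apply/eqP.
by rewrite -sqrf_eq0; exact: (h i (mem_index_enum i)).
Qed.

Lemma sqnormZ t z : sqnorm (t *: z) = t ^+ 2 * sqnorm z.
Proof. by rewrite /sqnorm mulr_sumr; apply: eq_bigr => i _; rewrite mxE exprMn. Qed.

(* Radial rescaling of the triangle [gauge <= 2] onto the unit disk; its value
   at [0] is [0] since [0^-1 = 0]. *)
Definition round (z : 'rV[R]_2) : 'rV[R]_2 :=
  (gauge z / 2 / Num.sqrt (sqnorm z)) *: z.

Lemma round0 : round 0 = 0. Proof. by rewrite /round scaler0. Qed.

Lemma sqnorm_round z : sqnorm (round z) = (gauge z / 2) ^+ 2.
Proof.
have [->|z0] := eqVneq z 0.
  by rewrite round0 gauge0 mul0r expr0n -(scale0r 0) sqnormZ expr0n mul0r.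
rewrite sqnormZ exprMn exprVn sqr_sqrtr ?sqnorm_ge0 // mulfVK //.
by rewrite gt_eqF // sqnorm_gt0.
Qed.

Lemma disk_round z : disk (round z) <-> gauge z <= 2.
Proof.
rewrite /disk /= -/(sqnorm (round z)) sqnorm_round.
have := gauge_ge0 z => g0; rewrite expr_le1 // ?ler_pdivrMr ?mul1r //.
by rewrite divr_ge0.
Qed.

Lemma circle_round z : circle (round z) <-> gauge z = 2.
Proof.
rewrite /circle /= -/(sqnorm (round z)) sqnorm_round.
have g0 := gauge_ge0 z; split=> [/eqP|->]; last by rewrite divff // expr1n.
by rewrite sqrf_eq1 => /orP[] /eqP; lra.
Qed.

(** The norm of [round z] recovers [gauge z], and two points on the same ray from the origin with
    the same gauge coincide. *)
Lemma round_inj : injective round.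
Proof.
move=> z z' e; have g : gauge z = gauge z'.
  have /eqP := congr1 sqnorm e; rewrite !sqnorm_round eqrXn2 //.
  - by move/eqP; lra.
  - by rewrite divr_ge0 ?gauge_ge0.
  - by rewrite divr_ge0 ?gauge_ge0.
have [g0|g0] := eqVneq (gauge z) 0.
  by rewrite (gauge_eq0 g0); apply/esym/gauge_eq0; rewrite -g.
have nz u : gauge u != 0 -> 0 < Num.sqrt (sqnorm u).
  move=> gu; rewrite sqrtr_gt0 sqnorm_gt0 //.
  by apply: contra gu => /eqP ->; rewrite gauge0.
have [p p'] : 0 < Num.sqrt (sqnorm z) /\ 0 < Num.sqrt (sqnorm z').
  by split; apply: nz; rewrite -?g.
pose t := Num.sqrt (sqnorm z) / Num.sqrt (sqnorm z').
have t0 : 0 < t by rewrite divr_gt0.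
have zE : z = t *: z'.
  have c0 : gauge z / 2 / Num.sqrt (sqnorm z) != 0.
    by rewrite !mulf_neq0 ?invr_eq0 // gt_eqF.
  apply: (scalerI c0); rewrite -/(round z) e /round -g scalerA; congr (_ *: _).
  by rewrite /t; field; rewrite !gt_eqF.
have : gauge z = t * gauge z' by rewrite {1}zE gaugeZ // ltW.
rewrite -g -[LHS]mul1r => /(mulIf g0) t1.
by rewrite zE -t1 scale1r.
Qed.

Lemma round_surj y : exists z, round z = y.
Proof.
have [->|y0] := eqVneq y 0; first by exists 0; exact: round0.
have gy : gauge y != 0 by apply: contra y0 => /eqP/gauge_eq0 ->.
have gp : 0 < gauge y by rewrite lt_neqAle eq_sym gy gauge_ge0.
have ny : 0 < Num.sqrt (sqnorm y) by rewrite sqrtr_gt0 sqnorm_gt0.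
(* By homogeneity [round (t *: y)] is [t * gauge y / 2 / |y|] times [y]; this [t] makes the factor
   1. *)
pose t := 2 * Num.sqrt (sqnorm y) / gauge y.
have t0 : 0 < t by rewrite divr_gt0 // mulr_gt0.
exists (t *: y); rewrite /round gaugeZ ?ltW // sqnormZ sqrtrM ?sqr_ge0 //.
rewrite sqrtr_sqr gtr0_norm // scalerA -[RHS]scale1r; congr (_ *: _).
by rewrite /t; field; rewrite gy !gt_eqF.
Qed.

Lemma continuous_round : continuous round.
Proof.
have csq : continuous sqnorm.
  apply: continuous_sum => i; apply: continuousMT;
    by apply: continuous_coordT => x; exact: cvg_id.
have cg := continuous_gauge.
move=> z; have [->|z0] := eqVneq z 0; last first.
  apply: (@cvgZ _ _ _ (nbhs z)); last exact: cvg_id.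
  apply: (@cvgM _ _ (nbhs z)); first by apply: (@cvgM _ _ (nbhs z)); [exact: cg|exact: cvg_cst].
  apply: cvgV; first by rewrite gt_eqF // sqrtr_gt0 sqnorm_gt0.
  exact: (continuous_comp (csq z) (@sqrt_continuous _ _)).
(* At the origin the quotient degenerates, but each coordinate of [round u] is bounded by the norm
   [gauge u / 2], which tends to 0. *)
rewrite /continuous_at round0.
apply: (@cvg_mx _ (nbhs (0 : 'rV[R]_2)) _ _ _ round 0 (nbhs_filter _)) => i k.
rewrite ord1 mxE.
have g2 : gauge u / 2 @[u --> nbhs (0 : 'rV[R]_2)] --> 0.
  have c2 : continuous (fun u => gauge u / 2).
    by apply: continuousMT => //; exact: continuous_cstT.
  have : {for 0, continuous (fun u => gauge u / 2)} by exact: c2.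
  by rewrite /prop_for /continuous_at gauge0 mul0r.
apply/norm_cvg0P; apply: (@squeeze_cvgr _ _ _ _ (fun _ => 0) (fun u => gauge u / 2)).
- near=> u; rewrite normr_ge0 /=.
  have gu : 0 <= gauge u / 2 by rewrite divr_ge0 ?gauge_ge0.
  rewrite -(@ler_pXn2r _ 2) ?nnegrE // real_normK ?num_real // -sqnorm_round.
  by rewrite /sqnorm (bigD1 k) //= lerDl; apply: sumr_ge0 => j _; exact: sqr_ge0.
- exact: cvg_cst.
- exact: g2.
Unshelve. all: by end_near. Qed.

End planar_fan.

(** * General position *)

Section general_position.
Context {R : realType}.

Lemma poly_nonroot (P : {poly R}) : P != 0 -> exists t, P.[t] != 0.
Proof.
move=> P0; pose s := [seq k%:R : R | k <- iota 0 (size P)].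
have [/allP h|/allPn [t _ ht]] := boolP (all (root P) s); last by exists t.
suff : (size s < size P)%N by rewrite size_map size_iota ltnn.
apply: max_poly_roots => //; first exact/allP.
by rewrite map_inj_uniq ?iota_uniq // => a b /eqP; rewrite eqr_nat => /eqP.
Qed.

(* The moment curve meets each proper affine subspace finitely often. *)
Lemma avoid_affine_subspaces d (I : finType) (u : I -> 'rV[R]_d)
    (m : I -> nat) (S : forall i, 'M[R]_(m i, d)) :
  (forall i, (\rank (S i) < d)%N) -> exists x, forall i, ~~ (x - u i <= S i)%MS.
Proof.
move=> rS.
(* A nonzero column of the cokernel is a nonzero linear form that vanishes on [S i]; it exists
   because the rank is less than [d]. *)
have hj i : exists j, col j (cokermx (S i)) != 0.
  apply/existsP; apply: contraT; rewrite negb_exists => /forallP h.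
  have : cokermx (S i) = 0.
    apply/matrixP => a b; have := h b; rewrite negbK => /eqP/colP/(_ a).
    by rewrite !mxE.
  by move/eqP; rewrite -mxrank_eq0 mxrank_coker subn_eq0 leqNgt rS.
pose j i := xchoose (hj i); pose a i := (col (j i) (cokermx (S i)))^T.
have a0 i : a i != 0.
  rewrite /a -(inj_eq trmx_inj) trmxK trmx0; exact: (xchooseP (hj i)).
(* The value of the form on [x - u i] for [x] on the curve [(t, t^2, ..., t^d)]. The curve starts
   with [t], so the coefficients of the form sit in positive degrees and the constant coming from
   [u i] cannot cancel them. *)
pose P i := 'X * rVpoly (a i) - ((u i *m (a i)^T) 0 0)%:P.
have P0 i : P i != 0.
  apply: contra (a0 i) => /eqP Pi0; rewrite -[a i]rVpolyK.
  suff -> : rVpoly (a i) = 0 by rewrite linear0.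
  apply/polyP => k; rewrite coef0.
  have := congr1 (fun q : {poly R} => q`_k.+1) Pi0.
  by rewrite /P coefB coefXM coefC /= coef0 subr0.
have [|t ht] := @poly_nonroot (\prod_i P i).
  by apply/prodf_neq0 => i _.
exists (\row_k t ^+ k.+1) => i.
apply/negP; rewrite submxE => /eqP e.
set x := \row_k _ in e.
have h : ((x - u i) *m cokermx (S i)) 0 (j i) = 0 by rewrite e mxE.
move: ht; rewrite horner_prod => /prodf_neq0 /(_ i isT) /eqP; apply.
have hr : (rVpoly (a i)).[t] = \sum_(k < d) a i 0 k * t ^+ k.
  rewrite (horner_coef_wide _ (size_poly _ _)).
  by apply: eq_bigr => k _; rewrite coef_rVpoly_ord.
rewrite /P !hornerE hr -[RHS]h.
rewrite mulmxBl [RHS]mxE [X in _ = _ + X]mxE; congr (_ - _).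
  rewrite mulr_sumr [RHS]mxE; apply: eq_bigr => k _.
  by rewrite !mxE exprS; ring.
by rewrite !mxE; apply: eq_bigr => k _; rewrite !mxE.
Qed.

Lemma row_free_col_mx m d (S : 'M[R]_(m, d)) (v : 'rV[R]_d) :
  row_free S -> ~~ (v <= S)%MS -> row_free (col_mx S v).
Proof.
move=> Sf vS; apply: inj_row_free => w.
rewrite -[w]hsubmxK mul_row_col [rsubmx w]mx11_scalar mul_scalar_mx.
set c := rsubmx w 0 0 => e.
have c0 : c = 0.
  apply/eqP; apply: contraNT vS => cn0.
  have -> : v = (- c^-1 *: lsubmx w) *m S.
    rewrite -scalemxAl; move/eqP: e; rewrite addr_eq0 => /eqP ->.
    by rewrite scalerN scaleNr opprK scalerA mulVf // scale1r.
  exact: submxMl.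
have : lsubmx w *m S = 0 by move: e; rewrite c0 scale0r addr0.
move/eqP; rewrite mulmx_free_eq0 // => /eqP ->.
by rewrite c0 -scalemx1 scale0r row_mx0.
Qed.

Lemma row_free_rV d (v : 'rV[R]_d) : v != 0 -> row_free v.
Proof. by move=> v0; rewrite /row_free rank_rV v0. Qed.

Context {n : nat} (n_gt2 : (2 < n)%N) (p : 'I_n -> 'rV[R]_4).

Definition plane_point (A B1 B2 : 'rV[R]_4) (i : 'I_n) : 'rV[R]_4 :=
  A + @ray_x R n i *: B1 + ray_y i *: B2.

(** The first clause provides the basis for the projection at an inner vertex. The second and third
    keep the middle and the outer triangles off the polygon, with [j] and [k] the ends of an edge;
    the second, with [j] and [k] the two neighbours of [ordS i], also gives the independence needed
    at a rim vertex. *)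
Lemma generic_plane : (forall i, p i != p (ordS i)) ->
  exists A B1 B2, [/\
    forall i, row_free (col_mx (col_mx (col_mx (p i - A) (p (ordS i) - A)) B1) B2),
    forall i j k a b, let o := p (ordS i) in
      ((a *: (plane_point A B1 B2 i - o) + b *: (plane_point A B1 B2 (ordS i) - o))%R
        <= col_mx (p j - o) (p k - o))%MS -> a = 0 /\ b = 0 &
    forall i j k a, let o := p (ordS i) in
      (a *: (plane_point A B1 B2 i - o)
        <= col_mx (col_mx (p i - o) (p j - o)) (p k - o))%MS -> a = 0].
Proof.
move=> pS.
have rk m (S : 'M[R]_(m, 4)) : (m < 4)%N -> (\rank S < 4)%N.
  exact/leq_ltn_trans/rank_leq_row.
have [A hA] := @avoid_affine_subspaces 4 _ p _ (fun i => p (ordS i) - p i)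
  (fun i => rk 1%N _ isT).
(* The determinant of two neighbouring rays, which is the coefficient of [B1] once [B2] is
   eliminated between [q_i] and [q_(i+1)]. *)
pose D (i : 'I_n) := ray_y (ordS i) * @ray_x R n i - ray_y i * @ray_x R n (ordS i).
have D0 i : D i != 0 :> R.
  by have := @ray_det_neq0 R n n_gt2 i; rewrite /D mulrC [X in _ - X]mulrC.
pose S1 i := col_mx (p i - A) (p (ordS i) - A).
pose S2 (t : 'I_n * 'I_n * 'I_n) :=
  col_mx (p t.1.2 - p (ordS t.1.1)) (p t.2 - p (ordS t.1.1)).
pose e1 i := (ray_y (ordS i) - ray_y i) *: (A - p (ordS i)).
have [B1 hB1] := @avoid_affine_subspaces 4 ('I_n + ('I_n * 'I_n * 'I_n))%type
  (fun t => match t with inl i => 0 | inr t => - (D t.1.1)^-1 *: e1 t.1.1 end)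
  (fun _ => 1 + 1)%N
  (fun t => match t with inl i => S1 i | inr t => S2 t end) (fun t => rk 2%N _ isT).
(* [r i = y_(i+1) (q_i - o) - y_i (q_(i+1) - o)] does not involve [B2]. *)
pose r i := e1 i + D i *: B1.
pose S3 (t : 'I_n * 'I_n * 'I_n) :=
  col_mx (col_mx (p t.1.1 - p (ordS t.1.1)) (p t.1.2 - p (ordS t.1.1)))
    (p t.2 - p (ordS t.1.1)).
(* Chosen so that [q_i - o] is [ray_y i] times [B2 - e2 i]: keeping [q_i - o] out of a subspace
   becomes a condition on [B2]. *)
pose e2 (i : 'I_n) := - (ray_y i)^-1 *: (A - p (ordS i) + @ray_x R n i *: B1).
have [B2 hB2] := @avoid_affine_subspaces 4
  ('I_n + (('I_n * 'I_n * 'I_n) + ('I_n * 'I_n * 'I_n)))%type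
  (fun t => match t with inl i => 0 | inr (inl t) => e2 t.1.1
    | inr (inr t) => e2 t.1.1 end)
  (fun _ => 1 + 1 + 1)%N
  (fun t => match t with inl i => col_mx (S1 i) B1 | inr (inl t) => S3 t
    | inr (inr t) => col_mx (S2 t) (r t.1.1) end) (fun t => rk 3%N _ isT).
have y0 (i : 'I_n) : ray_y i != 0 :> R by apply: ray_y_neq0.
have qE i : plane_point A B1 B2 i - p (ordS i) = ray_y i *: (B2 - e2 i).
  rewrite /plane_point /e2 scalerBr scalerA mulrN divff // scaleN1r opprK.
  by rewrite [RHS]addrC addrAC; congr (_ + _); rewrite addrAC.
have rN (t : 'I_n * 'I_n * 'I_n) : ~~ (r t.1.1 <= S2 t)%MS.
  have /= := hB1 (inr t); apply: contra => h.
  have -> : B1 - - (D t.1.1)^-1 *: e1 t.1.1 = (D t.1.1)^-1 *: r t.1.1.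
    by rewrite /r scalerDr [_ *: (_ *: B1)]scalerA mulVf // scale1r scaleNr opprK addrC.
  exact: scalemx_sub.
exists A, B1, B2; split.
- move=> i; apply: row_free_col_mx; last by have /= := hB2 (inl i); rewrite subr0.
  apply: row_free_col_mx; last by have /= := hB1 (inl i); rewrite subr0.
  have hAi := hA i; apply: row_free_col_mx.
    apply: row_free_rV; rewrite subr_eq0; apply: contra hAi => /eqP ->.
    by rewrite subrr sub0mx.
  apply: contra hAi => /sub_rVP [c cE].
  have d0 : c - 1 != 0.
    apply: contra (pS i); rewrite subr_eq0 => /eqP c1.
    by move: cE; rewrite c1 scale1r => /addIr ->.
  apply/sub_rVP; exists (- (c - 1)^-1).
  have -> : p (ordS i) - p i = (c - 1) *: (p i - A).
    by rewrite scalerBl scale1r -cE opprB addrA subrK.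
  by rewrite scalerA mulNr mulVf // scaleN1r opprB.
- move=> i j k a b o h.
  (* Both [q_i] and [q_(i+1)] move with [B2]. Rewritten in terms of [q_i - o] and [r i], the
     combination loses its first coefficient by the choice of [B2], and then the second by that of
     [B1]. *)
  have yb : ray_y i *: (a *: (plane_point A B1 B2 i - o) +
      b *: (plane_point A B1 B2 (ordS i) - o)) =
      (ray_y i * a + ray_y (ordS i) * b) *: (plane_point A B1 B2 i - o) - b *: r i.
    rewrite /r /e1 /plane_point -/o /D; apply/rowP => l; rewrite !mxE; ring.
  pose g := ray_y i * a + ray_y (ordS i) * b.
  have {}h : ((g *: (plane_point A B1 B2 i - o) - b *: r i)%R <= S2 (i, j, k))%MS.
    by rewrite /g -yb; apply: scalemx_sub.
  have g0 : g = 0.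
    apply/eqP; apply: contraT => gn0; have /negP := hB2 (inr (inr (i, j, k))); case=> /=.
    have : (g *: (plane_point A B1 B2 i - o) <= col_mx (S2 (i, j, k)) (r i))%MS.
      rewrite -(subrK (b *: r i) (g *: _)); apply: addmx_sub.
        by apply: submx_trans h _; rewrite -(addsmxE (S2 (i, j, k)) (r i)) addsmxSl.
      by apply: scalemx_sub; rewrite -(addsmxE (S2 (i, j, k)) (r i)) addsmxSr.
    rewrite /o qE scalerA => /(scalemx_sub (g * ray_y i)^-1).
    by rewrite scalerA mulVf ?scale1r // mulf_neq0.
  have b0 : b = 0.
    apply/eqP; apply: contraT => bn0; have /negP := rN (i, j, k); case=> /=.
    move: h; rewrite g0 scale0r sub0r -scaleNr => /(scalemx_sub (- b)^-1).
    by rewrite scalerA mulVf ?scale1r // oppr_eq0.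
  split=> //; apply/eqP; move/eqP: g0.
  by rewrite /g b0 mulr0 addr0 mulf_eq0 (negPf (y0 _)).
- move=> i j k a o h; apply/eqP; apply: contraT => an0.
  have /negP := hB2 (inr (inl (i, j, k))); case=> /=.
  move: h; rewrite /o qE scalerA => /(scalemx_sub (a * ray_y i)^-1).
  by rewrite scalerA mulVf ?scale1r // mulf_neq0.
Qed.

End general_position.

(** * The abstract triangulated disk *)

Lemma simplex3P (R : realType) (m : nat) (u v w : 'I_m) (x : 'rV[R]_m) :
  u != v -> u != w -> v != w ->
  simplex [set u; v; w] x <-> exists a b c : R, [/\ 0 <= a, 0 <= b, 0 <= c,
    a + b + c = 1 & x = a *: delta_mx 0 u + b *: delta_mx 0 v + c *: delta_mx 0 w].
Proof.
move=> uv uw vw; split=> [[x0 x1 xS]|[a [b [c [a0 b0 c0 abc ->]]]]].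
  have split3 (V : zmodType) (F : 'I_m -> V) :
      (forall i, x 0 i = 0 -> F i = 0) -> \sum_i F i = F u + F v + F w.
    move=> hF; rewrite (bigD1 u) //= (bigD1 v) /=; last by rewrite eq_sym.
    rewrite (bigD1 w) /=; last by rewrite !(eq_sym w) uw.
    rewrite big1 ?addr0 ?addrA // => i /andP[/andP[iu iv] iw].
    by apply/hF/xS; rewrite !inE (negPf iu) (negPf iv) (negPf iw).
  exists (x 0 u), (x 0 v), (x 0 w); split=> //.
    by rewrite -(split3 _ (fun i => x 0 i)).
  rewrite [LHS]row_sum_delta (split3 _ (fun i => x 0 i *: delta_mx 0 i)) //.
  by move=> i ->; rewrite scale0r.
split=> [i||i].
- by rewrite !mxE /= !addr_ge0 // mulr_ge0 // ler0n.
- have sd k : \sum_(i < m) (i == k)%:R = 1 :> R.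
    rewrite (bigD1 k) //= eqxx big1 ?addr0 // => i /negPf ik.
    by rewrite ik.
  under eq_bigr do rewrite !mxE !eqxx /=.
  by rewrite !big_split /= -!mulr_sumr !sd !mulr1.
- rewrite !inE !negb_or => /andP[/andP[/negPf iu /negPf iv] /negPf iw].
  by rewrite !mxE iu iv iw !andbF !mulr0 !addr0.
Qed.

Lemma simplex2P (R : realType) (m : nat) (u v : 'I_m) (x : 'rV[R]_m) : u != v ->
  simplex [set u; v] x <-> exists a b : R, [/\ 0 <= a, 0 <= b,
    a + b = 1 & x = a *: delta_mx 0 u + b *: delta_mx 0 v].
Proof.
move=> uv; split=> [[x0 x1 xS]|[a [b [a0 b0 ab ->]]]].
  have split2 (V : zmodType) (F : 'I_m -> V) :
      (forall i, x 0 i = 0 -> F i = 0) -> \sum_i F i = F u + F v.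
    move=> hF; rewrite (bigD1 u) //= (bigD1 v) /=; last by rewrite eq_sym.
    rewrite big1 ?addr0 // => i /andP[iu iv].
    by apply/hF/xS; rewrite !inE (negPf iu) (negPf iv).
  exists (x 0 u), (x 0 v); split=> //.
    by rewrite -(split2 _ (fun i => x 0 i)).
  rewrite [LHS]row_sum_delta (split2 _ (fun i => x 0 i *: delta_mx 0 i)) //.
  by move=> i ->; rewrite scale0r.
split=> [i||i].
- by rewrite !mxE /= !addr_ge0 // mulr_ge0 // ler0n.
- have sd k : \sum_(i < m) (i == k)%:R = 1 :> R.
    rewrite (bigD1 k) //= eqxx big1 ?addr0 // => i /negPf ik.
    by rewrite ik.
  under eq_bigr do rewrite !mxE !eqxx /=.
  by rewrite !big_split /= -!mulr_sumr !sd !mulr1.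
- rewrite !inE !negb_or => /andP[/negPf iu /negPf iv].
  by rewrite !mxE iu iv !andbF !mulr0 !addr0.
Qed.

Lemma compact_realization (R : realType) (m : nat) (T : {set {set 'I_m}}) :
  compact (@realization R m T).
Proof.
have -> : @realization R m T = \big[setU/set0]_(t <- enum T) @simplex R m t.
  rewrite /realization -bigcup_seq; congr bigcup; apply/seteqP; split=> t /=;
    by rewrite mem_enum.
apply: bigsetU_compact => t _.
have cube_compact : compact [set v : 'rV[R]_m | forall i, v ord0 i \in `[(0 : R), 1]].
  apply: (@rV_compact R _ (fun=> `[(0 : R), 1]%classic)) => _.
  exact: segment_compact.
have cc i : continuous (fun x : 'rV[R]_m => x 0 i).
  by apply: continuous_coordT => x; exact: cvg_id.
apply: (subclosed_compact _ cube_compact); last first.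
  move=> x [x0 x1 _] i; rewrite in_itv /= x0 /= -x1 (bigD1 i) //= lerDl.
  exact: sumr_ge0.
have -> : @simplex R m t = (\bigcap_i [set x | 0 <= x 0 i]) `&`
    ([set x | \sum_i x 0 i = 1] `&` \bigcap_(i in [set i | i \notin t]) [set x | x 0 i = 0]).
  apply/seteqP; split=> x /=; first by move=> [x0 x1 xt]; split=> //; move=> i _; exact: x0.
  by move=> [x0 [x1 xt]]; split=> // i; exact: x0.
apply: closedI; first by apply: closed_bigI => i _; exact: closed_ge_continuous.
apply: closedI; first by apply: closed_eq_continuous; exact: continuous_sum.
by apply: closed_bigI => i _; exact: closed_eq_continuous.
Qed.

Section model_disk.
Context {R : realType} {n : nat} (n_gt2 : (2 < n)%N).
Notation m := (n + n + 1)%N.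

Definition outer (i : 'I_n) : 'I_m := lshift 1 (lshift n i).
Definition inner (i : 'I_n) : 'I_m := lshift 1 (rshift n i).
Definition center : 'I_m := rshift (n + n) ord0.

Variant vertex_spec : 'I_m -> Prop :=
| OuterVertex i : vertex_spec (outer i)
| InnerVertex i : vertex_spec (inner i)
| CenterVertex : vertex_spec center.

Lemma vertexP v : vertex_spec v.
Proof.
have [u ->|k ->] := split_ordP v; last by rewrite ord1; exact: CenterVertex.
by have [i ->|i ->] := split_ordP u; [exact: OuterVertex|exact: InnerVertex].
Qed.

Lemma vertex_eqE :
  ((forall i j, (outer i == outer j) = (i == j)) *
  (forall i j, (inner i == inner j) = (i == j)) *
  (forall i j, (outer i == inner j) = false) *
  (forall i j, (inner i == outer j) = false) *
  (forall i, (outer i == center) = false) *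
  (forall i, (inner i == center) = false) *
  (forall i, (center == outer i) = false) *
  (forall i, (center == inner i) = false))%type.
Proof. by do !split=> *; rewrite /outer /inner /center !eq_shift. Qed.

Local Opaque outer inner center.

Lemma ordS_neq (i : 'I_n) : ordS i != i.
Proof.
apply/eqP => /(congr1 val) /=; case: i => k kn /=.
have [kn1|nk] := ltnP k.+1 n; first by rewrite modn_small // => /eqP; rewrite eqn_leq ltnn.
have e : k.+1 = n by apply/eqP; rewrite eqn_leq kn.
by rewrite e modnn => k0; move: n_gt2; rewrite -e -k0.
Qed.

(** Here [n > 2] matters: with only two indices the central triangles of both would be the same
    vertex set. *)
Lemma ordSS_neq (i : 'I_n) : ordS (ordS i) != i.
Proof.
apply/eqP => /(congr1 val) /=; case: i => k kn /=.
have [kn1|nk] := ltnP k.+1 n; last first.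
  have e : k.+1 = n by apply/eqP; rewrite eqn_leq kn.
  rewrite e modnn modn_small ?(ltn_trans _ n_gt2) // => k1.
  by move: n_gt2; rewrite -e -k1.
rewrite (modn_small kn1); have [kn2|nk2] := ltnP k.+2 n.
  by rewrite modn_small // => /eqP; rewrite eqn_leq ltnNge leqnSn.
have e : k.+2 = n by apply/eqP; rewrite eqn_leq kn1.
by rewrite e modnn => k0; move: n_gt2; rewrite -e -k0.
Qed.

Lemma ordS_eq (i j : 'I_n) : (ordS i == ordS j) = (i == j).
Proof. exact: (inj_eq (@ordS_inj n)). Qed.

(** Each quadrilateral of the annulus is cut along the diagonal from [outer (ordS i)] to [inner i].
    Thus three triangles meet at an outer vertex, and an inner vertex [i] is joined only to the
    outer vertices [i] and [ordS i]. *)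
Definition outer_triangle i : {set 'I_m} := [set outer i; outer (ordS i); inner i].
Definition middle_triangle i : {set 'I_m} := [set outer (ordS i); inner i; inner (ordS i)].
Definition central_triangle i : {set 'I_m} := [set inner i; inner (ordS i); center].

Definition model_triangles : {set {set 'I_m}} :=
  [set outer_triangle i | i : 'I_n] :|: [set middle_triangle i | i : 'I_n]
  :|: [set central_triangle i | i : 'I_n].

Lemma model_triangleP t : t \in model_triangles <->
  exists i, [\/ t = outer_triangle i, t = middle_triangle i | t = central_triangle i].
Proof.
rewrite !inE; split.
  by move=> /orP[/orP[]|] /imsetP[i _ ->]; exists i; [constructor 1|constructor 2|constructor 3].
move=> [i [] ->]; rewrite imset_f ?orbT //.
Qed.

Lemma card_model_triangle t : t \in model_triangles -> #|t| = 3.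
Proof.
have c3 (u v w : 'I_m) : u != v -> u != w -> v != w -> #|[set u; v; w]%SET| = 3.
  by move=> uv uw vw; rewrite -finset.setUA !cardsU1 !inE negb_or uv uw vw cards1.
by move=> /model_triangleP[i [] ->]; apply: c3;
  rewrite ?vertex_eqE // eq_sym ordS_neq.
Qed.

Lemma card_model_triangles : #|model_triangles| = (3 * n)%N.
Proof.
have oI : injective outer_triangle.
  move=> i j /setP /(_ (inner i)); rewrite !inE !vertex_eqE eqxx /=.
  by move/esym/eqP.
have mI : injective middle_triangle.
  move=> i j /setP /(_ (outer (ordS i))); rewrite !inE !vertex_eqE eqxx /= !orbF.
  by rewrite ordS_eq => /esym/eqP.
have cI : injective central_triangle.
  move=> i j /setP E; have := E (inner i); have := E (inner (ordS i)).
  rewrite !inE !vertex_eqE !eqxx !orbT /= !orbF => /esym + /esym.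
  move=> h /orP[/eqP //|/eqP iE]; move: h.
  by rewrite iE (negPf (ordSS_neq j)) (negPf (ordS_neq _)).
rewrite /model_triangles !cardsU !card_imset // !card_ord.
rewrite (_ : _ :&: _ = finset.set0) ?cards0 ?subn0.
  rewrite (_ : _ :&: _ = finset.set0) ?cards0 ?subn0; first by rewrite !mulSn mul0n addn0 addnA.
  apply/setP => t; rewrite !inE; apply/negP => /andP[h /imsetP[j _ tE]]; move: h.
  by rewrite tE => /orP[] /imsetP[i _ /setP /(_ center)]; rewrite !inE !vertex_eqE eqxx !orbT.
apply/setP => t; rewrite !inE; apply/negP => /andP[/imsetP[i _ ->] /imsetP[j _ /setP E]].
have := E (inner j); have := E (inner (ordS j)).
rewrite !inE !vertex_eqE !eqxx !orbT /= => /eqP <- /eqP /esym/eqP.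
by rewrite (negPf (ordS_neq _)).
Qed.

Notation e := (delta_mx 0 : 'I_m -> 'rV[R]_m).

Variant model_point : 'rV[R]_m -> Prop :=
| OuterPoint i a b c of 0 <= a & 0 <= b & 0 <= c & a + b + c = 1 :
    model_point (a *: e (outer i) + b *: e (outer (ordS i)) + c *: e (inner i))
| MiddlePoint i a b c of 0 <= a & 0 <= b & 0 <= c & a + b + c = 1 :
    model_point (a *: e (outer (ordS i)) + b *: e (inner i) + c *: e (inner (ordS i)))
| CentralPoint i a b c of 0 <= a & 0 <= b & 0 <= c & a + b + c = 1 :
    model_point (a *: e (inner i) + b *: e (inner (ordS i)) + c *: e center).

Lemma model_simplexP i (x : 'rV[R]_m) :
  [/\ simplex (outer_triangle i) x <-> exists a b c, [/\ 0 <= a, 0 <= b, 0 <= c,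
        a + b + c = 1 & x = a *: e (outer i) + b *: e (outer (ordS i)) + c *: e (inner i)],
      simplex (middle_triangle i) x <-> exists a b c, [/\ 0 <= a, 0 <= b, 0 <= c,
        a + b + c = 1 & x = a *: e (outer (ordS i)) + b *: e (inner i) + c *: e (inner (ordS i))] &
      simplex (central_triangle i) x <-> exists a b c, [/\ 0 <= a, 0 <= b, 0 <= c,
        a + b + c = 1 & x = a *: e (inner i) + b *: e (inner (ordS i)) + c *: e center]].
Proof.
by split; apply: simplex3P; rewrite ?vertex_eqE // eq_sym ordS_neq.
Qed.

Lemma model_pointP x : realization model_triangles x <-> model_point x.
Proof.
split.
  move=> [t /= /model_triangleP [i ti] xt]; have [h1 h2 h3] := model_simplexP i x.
  case: ti xt => ->.
  - by move/h1 => [a [b [c [? ? ? ? ->]]]]; apply: OuterPoint.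
  - by move/h2 => [a [b [c [? ? ? ? ->]]]]; apply: MiddlePoint.
  - by move/h3 => [a [b [c [? ? ? ? ->]]]]; apply: CentralPoint.
case=> i a b c a0 b0 c0 abc.
- exists (outer_triangle i); first by apply/model_triangleP; exists i; constructor 1.
  by have [h _ _] := model_simplexP i (a *: e (outer i) + b *: e (outer (ordS i)) + c *: e (inner i));
    apply/h; exists a, b, c.
- exists (middle_triangle i); first by apply/model_triangleP; exists i; constructor 2.
  by have [_ h _] := model_simplexP i (a *: e (outer (ordS i)) + b *: e (inner i) + c *: e (inner (ordS i)));
    apply/h; exists a, b, c.
- exists (central_triangle i); first by apply/model_triangleP; exists i; constructor 3.
  by have [_ _ h] := model_simplexP i (a *: e (inner i) + b *: e (inner (ordS i)) + c *: e center);
    apply/h; exists a, b, c.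
Qed.

(** * The piecewise linear model map onto the triangle of gauge at most 2 *)

Definition vertex_mx d (P Q : 'I_n -> 'rV[R]_d) (C : 'rV[R]_d) : 'M[R]_(m, d) :=
  col_mx (col_mx (\matrix_i P i) (\matrix_i Q i)) C.

Lemma vertex_mxE d (P Q : 'I_n -> 'rV[R]_d) C :
  ((forall i, e (outer i) *m vertex_mx P Q C = P i) *
   (forall i, e (inner i) *m vertex_mx P Q C = Q i) *
   (e center *m vertex_mx P Q C = C))%type.
Local Transparent outer inner center.
Proof.
split=> [|]; last by rewrite -rowE /vertex_mx /center; apply/rowP => j; rewrite mxE col_mxEd.
by split=> i; rewrite -rowE /vertex_mx; apply/rowP => j;
  rewrite mxE col_mxEu ?col_mxEu ?col_mxEd mxE.
Qed.
Local Opaque outer inner center.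

Definition model_mx : 'M[R]_(m, 2) := vertex_mx (fun i => 2 *: ray i) (@ray R n) 0.

Lemma model_mx_outer i a b c :
  (a *: e (outer i) + b *: e (outer (ordS i)) + c *: e (inner i)) *m model_mx
     = ray_pair i (2 * a + c) (2 * b).
Proof.
rewrite !mulmxDl -!scalemxAl /model_mx !vertex_mxE /ray_pair !scalerA scalerDl.
by rewrite ![_ * 2]mulrC addrAC.
Qed.

Lemma model_mx_middle i a b c :
  (a *: e (outer (ordS i)) + b *: e (inner i) + c *: e (inner (ordS i))) *m model_mx
     = ray_pair i b (2 * a + c).
Proof.
rewrite !mulmxDl -!scalemxAl /model_mx !vertex_mxE /ray_pair !scalerA scalerDl.
by rewrite ![_ * 2]mulrC addrA [_ + b *: _]addrC.
Qed.

Lemma model_mx_central i a b c :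
  (a *: e (inner i) + b *: e (inner (ordS i)) + c *: e center) *m model_mx
     = ray_pair i a b.
Proof.
by rewrite !mulmxDl -!scalemxAl /model_mx !vertex_mxE /ray_pair scaler0 addr0.
Qed.

(* The outer coordinate of index [k] is recovered from the total coefficients
   [s], [s'] of the rays [k], [k + 1] and the sum [N] of all coefficients. *)
Definition coord_min (s s' N : R) : R :=
  Num.min (s / 2) (Num.max 0 (N - 1 - s' / 2)).

(** The last three clauses express every barycentric coordinate through the ray coefficients and
    their sum, hence through the planar image. The model map is thereby injective on the whole
    complex, with no comparison of pairs of triangles. *)
Lemma model_point_ray x : model_point x -> exists i a b,
  [/\ 0 <= a, 0 <= b, a + b <= 2, x *m model_mx = ray_pair i a b &
  [/\ forall k, 2 * x 0 (outer k) + x 0 (inner k) = pair_coef i a b k,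
    forall k, x 0 (outer k) =
      coord_min (pair_coef i a b k) (pair_coef i a b (ordS k)) (a + b) &
    \sum_k (x 0 (outer k) + x 0 (inner k)) + x 0 center = 1]].
Proof.
have sd j (c : R) : \sum_(i < n) c * (i == j)%:R = c.
  rewrite (bigD1 j) //= eqxx mulr1 big1 ?addr0 // => i /negPf ij.
  by rewrite ij mulr0.
have nSi i : (i == ordS i :> 'I_n) = false by rewrite eq_sym (negPf (ordS_neq i)).
have nSSi i : (i == ordS (ordS i) :> 'I_n) = false by rewrite eq_sym (negPf (ordSS_neq i)).
case=> i a b c a0 b0 c0 abc.
- exists i, (2 * a + c), (2 * b); split; [lra|lra|lra| |].
    exact: model_mx_outer.
  split=> [k|k|].
  + by rewrite /pair_coef !mxE !vertex_eqE /=; ring.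
  + rewrite /coord_min /pair_coef !mxE !vertex_eqE /= ordS_eq.
    have [->|ki] := eqVneq k i.
      rewrite nSi (negPf (ordS_neq _)) /=.
      by rewrite max_r ?min_r; lra.
    have [->|kSi] := eqVneq k (ordS i).
      rewrite (negPf (ordSS_neq _)) /=.
      by rewrite max_r ?min_l; lra.
    by rewrite /= !mulr0 !addr0 !mul0r min_l // le_max lexx.
  + under eq_bigr do rewrite !mxE !vertex_eqE !eqxx /= !mulr0 !addr0 !add0r.
    by rewrite !big_split /= !sd !mxE !vertex_eqE ?eqxx /=; lra.
- exists i, b, (2 * a + c); split; [lra|lra|lra| |].
    exact: model_mx_middle.
  split=> [k|k|].
  + by rewrite /pair_coef !mxE !vertex_eqE /=; ring.
  + rewrite /coord_min /pair_coef !mxE !vertex_eqE /= ordS_eq.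
    have [->|ki] := eqVneq k i.
      rewrite nSi (negPf (ordS_neq _)) /=.
      by rewrite max_l ?min_r; lra.
    have [->|kSi] := eqVneq k (ordS i).
      rewrite (negPf (ordSS_neq _)) /=.
      by rewrite max_r ?min_r; lra.
    by rewrite /= !mulr0 !addr0 !mul0r min_l // le_max lexx.
  + under eq_bigr do rewrite !mxE !vertex_eqE !eqxx /= !mulr0 !addr0 !add0r.
    by rewrite !big_split /= !sd !mxE !vertex_eqE ?eqxx /=; lra.
- exists i, a, b; split; [lra|lra|lra| |].
    exact: model_mx_central.
  split=> [k|k|].
  + by rewrite /pair_coef !mxE !vertex_eqE /=; ring.
  + rewrite /coord_min /pair_coef !mxE !vertex_eqE /= ordS_eq.
    have pn (u v : bool) : 0 <= a * u%:R + b * v%:R by rewrite addr_ge0 // mulr_ge0.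
    have p1 := pn (k == i) (k == ordS i).
    have p2 := pn (ordS k == i) (k == i).
    by rewrite max_l ?min_r; lra.
  + under eq_bigr do rewrite !mxE !vertex_eqE !eqxx /= !mulr0 !addr0 !add0r.
    by rewrite !big_split /= !sd !mxE !vertex_eqE ?eqxx /=; lra.
Qed.

Notation L := (fun x : 'rV[R]_m => x *m model_mx).

Lemma model_mx_inj x y : model_point x -> model_point y ->
  x *m model_mx = y *m model_mx -> x = y.
Proof.
move=> /model_point_ray [i [a [b [a0 b0 ab -> [sx ox tx]]]]].
move=> /model_point_ray [j [c [d [c0 d0 cd -> [sy oy ty]]]]] E.
have pE := ray_pair_inj n_gt2 a0 b0 c0 d0 E.
have gE := congr1 (@gauge R n) E; rewrite !gauge_ray_pair // in gE.
have oE k : x 0 (outer k) = y 0 (outer k) by rewrite ox oy !pE gE.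
have iE k : x 0 (inner k) = y 0 (inner k).
  by have := sx k; rewrite pE -sy oE => /addrI.
apply/rowP => v; case: (vertexP v) => // .
by move: tx; rewrite -ty; under eq_bigr do rewrite oE iE; move/addrI.
Qed.

Lemma model_mx_surj z : @gauge R n z <= 2 -> exists2 x, model_point x & x *m model_mx = z.
Proof.
have [i [a [b [a0 b0 ->]]]] := ray_pair_surj n_gt2 z.
rewrite gauge_ray_pair // => ab.
have [ab1|ab1] := leP (a + b) 1.
  exists (a *: e (inner i) + b *: e (inner (ordS i)) + (1 - (a + b)) *: e center).
    by apply: CentralPoint; lra.
  by rewrite model_mx_central.
(* The line [b = 2 (a + b - 1)] passes through [ray i] and [2 *: ray (ordS i)]: it is the diagonal
   between the outer and the middle triangle. *)
have [b2|b2] := leP b (2 * (a + b - 1)).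
  exists ((a + b - 1 - b / 2) *: e (outer i) + (b / 2) *: e (outer (ordS i))
    + (2 - (a + b)) *: e (inner i)).
    by apply: OuterPoint; lra.
  by rewrite model_mx_outer; congr ray_pair; lra.
exists ((a + b - 1) *: e (outer (ordS i)) + a *: e (inner i)
  + (b - 2 * (a + b - 1)) *: e (inner (ordS i))).
  by apply: MiddlePoint; lra.
by rewrite model_mx_middle; congr ray_pair; lra.
Qed.

Definition rim_point i (a b : R) : 'rV[R]_m :=
  a *: e (outer i) + b *: e (outer (ordS i)).

Definition rim (x : 'rV[R]_m) : Prop :=
  exists i a b, [/\ 0 <= a, 0 <= b, a + b = 1 & x = rim_point i a b].

Lemma rim_model_point x : rim x -> model_point x.
Proof.
move=> [i [a [b [a0 b0 ab ->]]]].
rewrite /rim_point -[X in model_point X]addr0 -(scale0r (e (inner i))).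
by apply: OuterPoint; rewrite ?addr0.
Qed.

Lemma gauge_rim x : model_point x -> @gauge R n (x *m model_mx) = 2 <-> rim x.
Proof.
move=> xm; split; last first.
  move=> [i [a [b [a0 b0 ab ->]]]].
  rewrite /rim_point -[X in X *m _]addr0 -(scale0r (e (inner i))) model_mx_outer.
  by rewrite gauge_ray_pair //; lra.
case: xm => i a b c a0 b0 c0 abc.
- rewrite model_mx_outer gauge_ray_pair; [move=> g|by []|lra|lra].
  exists i, a, b; split=> //; first by lra.
  by rewrite (_ : c = 0) ?scale0r ?addr0 //; lra.
- rewrite model_mx_middle gauge_ray_pair; [move=> g|by []|lra|lra].
  exists i, 0, 1; split=> //; first by rewrite add0r.
  have [-> [-> ->]] : a = 1 /\ b = 0 /\ c = 0 by do !split; lra.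
  by rewrite /rim_point !scale0r !addr0 add0r.
- by rewrite model_mx_central gauge_ray_pair; [move=> g; exfalso; lra|by []|lra|lra].
Qed.

Lemma gauge_model x : model_point x -> @gauge R n (x *m model_mx) <= 2.
Proof.
by move=> /model_point_ray [i [a [b [a0 b0 ab -> _]]]]; rewrite gauge_ray_pair.
Qed.

Lemma continuous_model_mx : continuous (fun x : 'rV[R]_m => x *m model_mx).
Proof. exact: continuous_mulmxl. Qed.

Lemma center_model_point : model_point (e center).
Proof.
have n0 : (0 < n)%N by apply: ltn_trans n_gt2.
rewrite (_ : e center = 0 *: e (inner (Ordinal n0)) +
  0 *: e (inner (ordS (Ordinal n0))) + 1 *: e center); last first.
  by rewrite !scale0r !add0r scale1r.
by apply: CentralPoint; rewrite ?addr0 ?add0r.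
Qed.

Lemma model_embedding :
  embedding_on (realization model_triangles) (fun x : 'rV[R]_m => x *m model_mx).
Proof.
apply: homeomorphism_on_compact => //.
- exists (e center); apply/model_pointP; exact: center_model_point.
- exact: compact_realization.
- by apply: continuous_subspaceT; exact: continuous_model_mx.
- move=> x y /[!inE] /model_pointP xm /model_pointP ym; exact: model_mx_inj.
Qed.

(** The model map is open at interior points: its image contains the open set of gauge less than 2,
    and its continuous inverse pulls the condition on the coordinate [v] back to a neighbourhood. *)
Lemma model_mx_open x v (d : R) : model_point x -> @gauge R n (x *m model_mx) < 2 ->
  d < x 0 v ->
  nbhs (x *m model_mx)
    [set z | exists y, [/\ model_point y, d <= y 0 v & y *m model_mx = z]].
Proof.
move=> xm xg dx; have [g [[_ cg] _ gS gK Kg]] := model_embedding.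
have imP z : @gauge R n z <= 2 -> ([set x *m model_mx | x in realization model_triangles]) z.
  by move=> /model_mx_surj [y /model_pointP ym <-]; exists y.
have /subspace_continuousP /(_ _ (imP _ (ltW xg))) gx := cg.
have xK : g (x *m model_mx) = x by rewrite gK // inE; apply/model_pointP.
have Ud : nbhs (g (x *m model_mx)) [set y : 'rV[R]_m | d < y 0 v].
  rewrite xK; have : open [set y : 'rV[R]_m | d < y 0 v].
    by apply: open_gt_continuous; exact: coord_continuous.
  by rewrite openE => /(_ x); apply.
have Ug : nbhs (x *m model_mx) [set z |
    ([set x *m model_mx | x in realization model_triangles]) z -> d < g z 0 v].
  exact: gx Ud.
have Og : nbhs (x *m model_mx) [set z | @gauge R n z < 2].
  have : open [set z | @gauge R n z < 2 :> R].
    by apply: open_lt_continuous; exact: continuous_gauge.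
  by rewrite openE; apply.
apply: filterS (filterI Ug Og) => z [/= hz gz]; have zi := imP _ (ltW gz).
exists (g z); split; last by rewrite Kg // inE.
- by apply/model_pointP; exact: gS.
- exact/ltW/hz.
Qed.

Lemma model_disk : exists S : triangulated_disk R m,
  [/\ triangles S = model_triangles & forall x, boundary S x <-> rim x].
Proof.
(* [h] goes from the complex to the disk, so the parametrization is its inverse; the circle
   corresponds to gauge 2, that is, to the rim. *)
pose h (x : 'rV[R]_m) := @round R n (x *m model_mx).
have ch : continuous h.
  by apply: continuous_compT; [exact: continuous_model_mx|exact: continuous_round].
have hE : h @` realization model_triangles = @disk R.
  apply/seteqP; split=> [_ [x /model_pointP xm <-]|y dy].
    by apply/disk_round => //; exact: gauge_model.
  have [z zy] := round_surj n_gt2 y.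
  have [|x /model_pointP xm xz] := @model_mx_surj z.
    by apply/(disk_round n_gt2); rewrite zy.
  by exists x => //; rewrite /h xz.
have hI : set_inj (realization model_triangles) h.
  move=> x y /[!inE] /model_pointP xm /model_pointP ym /(round_inj n_gt2).
  exact: model_mx_inj.
have : embedding_on (realization model_triangles) h.
  apply: homeomorphism_on_compact => //; last exact: continuous_subspaceT.
    exists (e center); apply/model_pointP; exact: center_model_point.
  exact: compact_realization.
rewrite /embedding_on hE => /homeomorphism_on_inverse [g [hg hK gK]].
exists (TriangulatedDisk card_model_triangle hg); split=> // x.
have cP y : circle (h y) <-> @gauge R n (y *m model_mx) = 2 by exact: circle_round.
split.
  move=> [z cz <-] /=.
  have dz : disk z by rewrite /disk /= cz.
  have gm : model_point (g z).
    by apply/model_pointP; case: hg => k [_ gS _ _ _]; exact: gS.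
  by apply/(gauge_rim gm)/cP; rewrite gK // inE.
move=> xr; have xm := rim_model_point xr.
exists (h x); first by apply/cP/gauge_rim.
by rewrite /= hK // inE; apply/model_pointP.
Qed.

End model_disk.

(** * Projections at the vertices *)

Section projections.
Context {R : realType}.

Lemma row_free_solve k d r (V : 'M[R]_(k, d)) (T : 'M[R]_(k, r)) :
  row_free V -> exists X, V *m X = T.
Proof. by move=> Vf; exists (pinvmx V *m T); rewrite mulmxA mulmxVp // mul1mx. Qed.

Lemma rank_projection d (X : 'M[R]_(d, 2)) (u v : 'rV[R]_d) :
  u *m X = delta_mx 0 0 -> v *m X = delta_mx 0 1 -> \rank X = 2%N.
Proof.
move=> uX vX; apply/eqP; rewrite eqn_leq rank_leq_col /= -[leqLHS](mxrank1 R 2).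
have <- : (col_mx u v : 'M[R]_(1 + 1, d)) *m X = 1%:M.
  rewrite mul_col_mx uX vX; apply/matrixP => a b.
  have [k ->|k ->] := split_ordP a; rewrite ?col_mxEu ?col_mxEd !mxE ord1 /=;
    by rewrite eq_sym; congr (nat_of_bool _)%:R; apply/eqP/eqP => [->|<-]; exact: val_inj.
exact: mxrankM_maxr.
Qed.

Lemma sub_col_mx2 d (u v : 'rV[R]_d) a b : ((a *: u + b *: v)%R <= col_mx u v)%MS.
Proof.
by rewrite -!mul_scalar_mx -mul_row_col submxMl.
Qed.

Lemma sub_col_mx3 d (u v w : 'rV[R]_d) a b c :
  ((a *: u + b *: v + c *: w)%R <= col_mx (col_mx u v) w)%MS.
Proof. by rewrite -!mul_scalar_mx -!mul_row_col submxMl. Qed.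

Context {n : nat} (n_gt2 : (2 < n)%N) (p : 'I_n -> 'rV[R]_4) (A B1 B2 : 'rV[R]_4).

Lemma polygon_vertex_neq i : closed_polygonal_curve p -> p i != p (ordS i).
Proof.
move=> [_ h]; apply/eqP => E.
have in0 : 0 \in `[(0 : R), 1[ by rewrite in_itv /= lexx ltr01.
have [|/esym/eqP] := h i (ordS i) 0 0 in0 in0.
  by rewrite /seg_point !subr0 !scale1r !scale0r !addr0.
by rewrite (negPf (ordS_neq n_gt2 i)).
Qed.

Local Notation q := (plane_point A B1 B2).
Hypothesis G1 : forall i,
  row_free (col_mx (col_mx (col_mx (p i - A) (p (ordS i) - A)) B1) B2).
Hypothesis G2 : forall i j k a b, let o := p (ordS i) in
  ((a *: (q i - o) + b *: (q (ordS i) - o))%R <= col_mx (p j - o) (p k - o))%MS ->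
  a = 0 /\ b = 0.
Hypothesis G3 : forall i j k a, let o := p (ordS i) in
  (a *: (q i - o) <= col_mx (col_mx (p i - o) (p j - o)) (p k - o))%MS -> a = 0.

(** By [G1] four vectors form a basis, so [X] may be prescribed on them; sending [B1] and [B2] to
    the standard basis then puts all the [q j] in place at once. *)
Lemma interior_projection i : exists X : 'M[R]_(4, 2),
  [/\ \rank X = 2%N, p i *m X = A *m X + 2 *: ray i,
    p (ordS i) *m X = A *m X + 2 *: ray (ordS i) &
    forall j : 'I_n, q j *m X = A *m X + ray j].
Proof.
have [X] := row_free_solve (col_mx (col_mx (col_mx (2 *: ray i) (2 *: ray (ordS i)))
  (delta_mx 0 0)) (delta_mx 0 1) : 'M[R]_(1 + 1 + 1 + 1, 2)) (G1 i).
rewrite !mul_col_mx => /eq_col_mx [/eq_col_mx [/eq_col_mx [X1 X2] X3] X4].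
exists X; split.
- exact: rank_projection X3 X4.
- by rewrite -X1 mulmxBl addrC subrK.
- by rewrite -X2 mulmxBl addrC subrK.
- move=> j; rewrite /plane_point !mulmxDl -!scalemxAl X3 X4 -addrA; congr (_ + _).
  by apply: rV2P; rewrite !mxE /=; ring.
Qed.

(** Seen from [o], the link [P_(i+2), Q_(i+1), Q_i, P_i] goes to [(0, -1)], [(1, 0)], [(1, 1)],
    [(0, l)], which sweep a half plane in this order. If the two edges at [o] are not collinear, the
    four vectors are independent and [l = 1]; otherwise [l] is forced to be the ratio of their
    lengths. *)
Lemma boundary_projection i (o := p (ordS i)) : closed_polygonal_curve p ->
  exists (X : 'M[R]_(4, 2)) (l : R), [/\ \rank X = 2%N, 0 < l,
    (p (ordS (ordS i)) - o) *m X = - delta_mx 0 1 /\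
    (p i - o) *m X = l *: delta_mx 0 1,
    (q (ordS i) - o) *m X = delta_mx 0 0 &
    (q i - o) *m X = delta_mx 0 0 + delta_mx 0 1].
Proof.
move=> hP; have [_ hp] := hP.
have pS j : p j - p (ordS j) != 0 by rewrite subr_eq0 polygon_vertex_neq.
set u := p i - o; set v := p (ordS (ordS i)) - o.
have v0 : v != 0 by rewrite /v /o -opprB oppr_eq0 pS.
(* By [G2] the vectors from [o] to [q (ordS i)] and [q i] are independent modulo the span of [u] and
   [v]. *)
have ext k (S : 'M[R]_(k, 4)) : row_free S -> (S <= col_mx u v)%MS ->
    row_free (col_mx (col_mx S (q (ordS i) - o)) (q i - o)).
  move=> Sf Suv; apply: row_free_col_mx.
    apply: row_free_col_mx => //; apply/negP => h.
    have [|_] := G2 (i := i) (j := i) (k := ordS (ordS i)) (a := 0) (b := 1).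
      by rewrite scale0r add0r scale1r; exact: submx_trans Suv.
    by move/eqP; rewrite oner_eq0.
  apply/negP => /submxP [D]; rewrite -[D]hsubmxK mul_row_col.
  rewrite [rsubmx D]mx11_scalar mul_scalar_mx => E.
  have [|] := G2 (i := i) (j := i) (k := ordS (ordS i)) (a := 1) (b := - rsubmx D 0 0).
    rewrite scale1r -/o E scaleNr addrK; apply: submx_trans Suv; exact: submxMl.
  by move/eqP; rewrite oner_eq0.
have fin (X : 'M[R]_(4, 2)) l : 0 < l -> v *m X = - delta_mx 0 1 ->
    u *m X = l *: delta_mx 0 1 -> (q (ordS i) - o) *m X = delta_mx 0 0 ->
    (q i - o) *m X = delta_mx 0 0 + delta_mx 0 1 -> exists (X : 'M[R]_(4, 2)) (l : R),
    [/\ \rank X = 2%N, 0 < l, v *m X = - delta_mx 0 1 /\ u *m X = l *: delta_mx 0 1,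
      (q (ordS i) - o) *m X = delta_mx 0 0 &
      (q i - o) *m X = delta_mx 0 0 + delta_mx 0 1].
  move=> l0 Xv Xu X1 X2; exists X, l; split=> //.
  by apply: (rank_projection X1 (v := - v)); rewrite mulNmx Xv opprK.
have [uv|uv] := boolP (u <= v)%MS; last first.
  have Vf : row_free (col_mx v u) by apply: row_free_col_mx => //; exact: row_free_rV.
  have Vuv : (col_mx v u <= col_mx u v)%MS by rewrite -!addsmxE addsmxC.
  have [X] := row_free_solve (col_mx (col_mx (col_mx (- delta_mx 0 1) (1 *: delta_mx 0 1))
    (delta_mx 0 0)) (delta_mx 0 0 + delta_mx 0 1) : 'M[R]_(1 + 1 + 1 + 1, 2))
    (ext _ _ Vf Vuv).
  rewrite !mul_col_mx => /eq_col_mx [/eq_col_mx [/eq_col_mx [X1 X2] X3] X4].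
  exact: (fin X 1).
have /sub_rVP [c uE] := uv.
(* Collinear edges must leave [o] in opposite directions. If [c > 0] they overlap: the point
   [o + s *: v] with [0 < s < min 1 c] lies on both, at parameter [1 - s / c] on the first and [s]
   on the second. *)
have c0 : c < 0.
  rewrite ltNge; apply/negP; rewrite le_eqVlt => /orP[/eqP c0|cp].
    by have := pS i; rewrite -/o -/u uE -c0 scale0r eqxx.
  pose s := Num.min 1 c / 2.
  have s0 : 0 < s by rewrite divr_gt0 // lt_min ltr01.
  have [s1 s2] : s < 1 /\ s < c.
    by rewrite /s; case: (leP 1 c) => ?; split; lra.
  have sc1 : s / c < 1 by rewrite ltr_pdivrMr // mul1r.
  have sc0 : 0 < s / c by rewrite divr_gt0.
  have [|||/eqP] := hp i (ordS i) (1 - s / c) s.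
  - by rewrite in_itv /=; apply/andP; split; lra.
  - by rewrite in_itv /= s1 ltW.
  - rewrite /seg_point -/o.
    have -> : p i = o + c *: v by rewrite -uE /u addrC subrK.
    have -> : p (ordS (ordS i)) = o + v by rewrite /v addrC subrK.
    apply/rowP => k; rewrite !mxE; field; exact: lt0r_neq0.
  - by rewrite eq_sym (negPf (ordS_neq n_gt2 i)).
have vuv : (v <= col_mx u v)%MS by rewrite -addsmxE addsmxSr.
have [X] := row_free_solve (col_mx (col_mx (- delta_mx 0 1)
  (delta_mx 0 0)) (delta_mx 0 0 + delta_mx 0 1) : 'M[R]_(1 + 1 + 1, 2))
  (ext _ _ (row_free_rV v0) vuv).
rewrite !mul_col_mx => /eq_col_mx [/eq_col_mx [X1 X3] X4].
apply: (fin X (- c)) => //; first by rewrite oppr_gt0.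
by rewrite uE -scalemxAl X1 scalerN scaleNr.
Qed.

End projections.

(** * The spanning disk *)

Section spanning_disk.
Context {R : realType} {n : nat} (n_gt2 : (2 < n)%N).
Variables (p : 'I_n -> 'rV[R]_4) (A B1 B2 : 'rV[R]_4).
Hypothesis hp : closed_polygonal_curve p.
Local Notation m := (n + n + 1)%N.
Local Notation e := (delta_mx 0 : 'I_m -> 'rV[R]_m).
Local Notation q := (plane_point A B1 B2).
Hypothesis G1 : forall i,
  row_free (col_mx (col_mx (col_mx (p i - A) (p (ordS i) - A)) B1) B2).
Hypothesis G2 : forall i j k a b, let o := p (ordS i) in
  ((a *: (q i - o) + b *: (q (ordS i) - o))%R <= col_mx (p j - o) (p k - o))%MS ->
  a = 0 /\ b = 0.
Hypothesis G3 : forall i j k a, let o := p (ordS i) in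
  (a *: (q i - o) <= col_mx (col_mx (p i - o) (p j - o)) (p k - o))%MS -> a = 0.

Definition disk_map (x : 'rV[R]_m) : 'rV[R]_4 := x *m vertex_mx p q A.
Local Notation f := disk_map.

Lemma disk_mapE i a b c :
  [/\ f (a *: e (outer i) + b *: e (outer (ordS i)) + c *: e (inner i))
        = a *: p i + b *: p (ordS i) + c *: q i,
      f (a *: e (outer (ordS i)) + b *: e (inner i) + c *: e (inner (ordS i)))
        = a *: p (ordS i) + b *: q i + c *: q (ordS i) &
      f (a *: e (inner i) + b *: e (inner (ordS i)) + c *: e center)
        = a *: q i + b *: q (ordS i) + c *: A].
Proof. by split; rewrite /f !mulmxDl -!scalemxAl !vertex_mxE. Qed.

Lemma disk_map_rim i a b : f (rim_point i a b) = a *: p i + b *: p (ordS i).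
Proof. by rewrite /f mulmxDl -!scalemxAl !vertex_mxE. Qed.

Lemma continuous_disk_map : continuous f.
Proof. exact: continuous_mulmxl. Qed.

Lemma affine_disk_map (D : set 'rV[R]_m) : affine_on f D.
Proof. by move=> x y t _ _ _; rewrite /f /seg_point mulmxDl -!scalemxAl. Qed.

(** An affine identity extends from the vertices to the triangle since the weights sum to 1. Each
    clause assumes only the outer vertices of its own triangle, because a projection is in standard
    position at two of them only. *)
Lemma triangle_chart (X : 'M[R]_(4, 2)) i a b c : a + b + c = 1 ->
    (forall j : 'I_n, q j *m X = A *m X + ray j) ->
  [/\ p i *m X = A *m X + 2 *: ray i -> p (ordS i) *m X = A *m X + 2 *: ray (ordS i) ->
      f (a *: e (outer i) + b *: e (outer (ordS i)) + c *: e (inner i)) *m X =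
      A *m X + (a *: e (outer i) + b *: e (outer (ordS i)) + c *: e (inner i)) *m model_mx,
    p (ordS i) *m X = A *m X + 2 *: ray (ordS i) ->
      f (a *: e (outer (ordS i)) + b *: e (inner i) + c *: e (inner (ordS i))) *m X =
      A *m X + (a *: e (outer (ordS i)) + b *: e (inner i) + c *: e (inner (ordS i))) *m model_mx &
    f (a *: e (inner i) + b *: e (inner (ordS i)) + c *: e center) *m X =
      A *m X + (a *: e (inner i) + b *: e (inner (ordS i)) + c *: e center) *m model_mx].
Proof.
move=> abc Xq; have [F1 F2 F3] := disk_mapE i a b c.
have comb (y u v w : 'rV[R]_2) :
    a *: (y + u) + b *: (y + v) + c *: (y + w) = y + (a *: u + b *: v + c *: w).
  by apply/rowP => k; rewrite !mxE (_ : c = 1 - a - b); [ring|lra].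
split.
- move=> Xp Xp'.
  by rewrite F1 !mulmxDl -!scalemxAl Xp Xp' Xq /model_mx !vertex_mxE comb.
- by move=> Xp'; rewrite F2 !mulmxDl -!scalemxAl Xp' !Xq /model_mx !vertex_mxE comb.
- rewrite F3 !mulmxDl -!scalemxAl !Xq /model_mx !vertex_mxE.
  by rewrite -(comb (A *m X)) addr0.
Qed.

(* On the star of an inner vertex [f] is, in the chart, the planar model. *)
Lemma interior_chart i : exists X : 'M[R]_(4, 2), \rank X = 2%N /\
  forall x, model_point x -> 0 < x 0 (inner i) \/ 0 < x 0 center ->
    f x *m X = A *m X + x *m model_mx.
Proof.
have [X [rX Xp Xp' Xq]] := interior_projection G1 i.
exists X; split=> // x [] j a b c a0 b0 c0 abc.
- rewrite !mxE !vertex_eqE /= !mulr0 !addr0 !add0r ltxx => -[] //.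
  have [<- _|] := eqVneq i j; last by rewrite mulr0 ltxx.
  by have [h _ _] := triangle_chart i abc Xq; exact: h.
- rewrite !mxE !vertex_eqE /= !mulr0 !addr0 !add0r ltxx => -[] // h.
  (* The middle triangle [j] contains the inner vertex [i] only for [i = j] or [i = ordS j], so its
     outer vertex is one of the two that [X] controls. *)
  have pX : p (ordS j) *m X = A *m X + 2 *: ray (ordS j).
    move: h; have [<- //|_] := eqVneq i j; have [<- //|_] := eqVneq i (ordS j).
    by rewrite !mulr0 addr0 ltxx.
  by have [_ h' _] := triangle_chart j abc Xq; exact: h'.
- by move=> _; have [_ _ ->] := triangle_chart j abc Xq.
Qed.

(** The projection attached to [i] is in standard position at every vertex of the three triangles of
    index [i], where injectivity is inherited from the planar model. *)
Lemma disk_map_simplex_inj t : t \in @model_triangles n -> set_inj (simplex t) f.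
Proof.
move=> tT; have /model_triangleP [i ti] := tT.
have [X [rX Xp Xp' Xq]] := interior_projection G1 i.
have sm y : simplex t y -> model_point y.
  by move=> yt; apply/(model_pointP n_gt2); exists t.
have XE y : simplex t y -> f y *m X = A *m X + y *m model_mx.
  have [h1 h2 h3] := model_simplexP n_gt2 i y.
  case: ti => ->.
  - move=> /h1 [a [b [c [_ _ _ abc ->]]]].
    by have [h _ _] := triangle_chart i abc Xq; exact: h.
  - move=> /h2 [a [b [c [_ _ _ abc ->]]]].
    by have [_ h _] := triangle_chart i abc Xq; exact: h.
  - move=> /h3 [a [b [c [_ _ _ abc ->]]]].
    by have [_ _ h] := triangle_chart i abc Xq; exact: h.
move=> y z /[!inE] ys zs E; apply: (model_mx_inj n_gt2); [exact: sm|exact: sm|].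
by apply: (addrI (A *m X)); rewrite -!XE // E.
Qed.

(** When [x 0 v] is positive, this is a neighbourhood of [x] which meets the complex inside the open
    star of [v]; being closed, it meets it in a compact set. *)
Definition star_nbhd (x : 'rV[R]_m) (v : 'I_m) : set 'rV[R]_m :=
  [set y | x 0 v / 2 <= y 0 v].

Lemma nbhs_star_nbhd (x : 'rV[R]_m) v : 0 < x 0 v -> nbhs x (star_nbhd x v).
Proof.
move=> xv; have : open [set y : 'rV[R]_m | x 0 v / 2 < y 0 v].
  by apply: open_gt_continuous; exact: coord_continuous.
rewrite openE => /(_ x) h; apply: filterS (h _) => [y /=|/=]; last by lra.
exact: ltW.
Qed.

Local Notation K := (@realization R m (@model_triangles n)).

Lemma compact_star_nbhd x v : compact (star_nbhd x v `&` K).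
Proof.
rewrite setIC; apply: compact_closedI; first exact: compact_realization.
by apply: closed_ge_continuous; exact: coord_continuous.
Qed.

Lemma embedding_star_nbhd (x : 'rV[R]_m) v : 0 < x 0 v -> K x ->
  set_inj (star_nbhd x v `&` K) f -> embedding_on (star_nbhd x v `&` K) f.
Proof.
move=> xv xK fI; apply: homeomorphism_on_compact => //.
- by exists x; split=> //; rewrite /star_nbhd /=; lra.
- exact: compact_star_nbhd.
- by apply: continuous_subspaceT; exact: continuous_disk_map.
Qed.

Lemma set_inj_comp (T U V : Type) (D : set T) (g : T -> U) (h : U -> V) :
  set_inj D (h \o g) -> set_inj D g /\ set_inj (g @` D) h.
Proof.
move=> hgI; split=> [x y xD yD e|u v /[!inE] -[x xD <-] [y yD <-] e].
  by apply: hgI => //=; rewrite e.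
by congr g; apply: hgI; rewrite ?inE.
Qed.

Lemma interior_star (x : 'rV[R]_m) v : model_point x -> @gauge R n (x *m model_mx) < 2 ->
  0 < x 0 v -> (exists i, v = inner i) \/ v = center ->
  set_inj (star_nbhd x v `&` K) f /\
  flat_at_interior (f @` (star_nbhd x v `&` K)) (f x).
Proof.
move=> xm xg xv hv; have n0 : (0 < n)%N by apply: ltn_trans n_gt2.
have [X [rX XE]] : exists X : 'M[R]_(4, 2), \rank X = 2%N /\
    forall y, model_point y -> 0 < y 0 v -> f y *m X = A *m X + y *m model_mx.
  case: hv => [[i ->]|->].
    have [X [rX XE]] := interior_chart i; exists X; split=> // y ym yv.
    by apply: XE => //; left.
  have [X [rX XE]] := interior_chart (Ordinal n0); exists X; split=> // y ym yv.
  by apply: XE => //; right.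
set U := star_nbhd x v `&` K.
have UP y : U y -> model_point y /\ 0 < y 0 v.
  by move=> [h /(model_pointP n_gt2) ym]; split=> //; move: h; rewrite /star_nbhd /=; lra.
have I : set_inj U ((mulmx^~ X) \o f).
  move=> y z /[!inE] /UP [ym yv] /UP [zm zv] /=.
  by rewrite !XE // => /addrI; exact: model_mx_inj.
have [fI XI] := set_inj_comp I; split=> //.
apply: (flat_at_interior_projection rX) => //.
- apply: continuous_compact; last exact: compact_star_nbhd.
  by apply: continuous_subspaceT; exact: continuous_disk_map.
- exists x => //; split; last exact/(model_pointP n_gt2).
  by rewrite /star_nbhd /=; lra.
- rewrite XE //.
  have hd : x 0 v / 2 < x 0 v by lra.
  have h := model_mx_open n_gt2 xm xg hd.
  have ct : continuous (fun z : 'rV[R]_2 => z - A *m X).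
    by apply: continuousBT => [z|]; [exact: cvg_id|exact: continuous_cstT].
  have h2 : nbhs (A *m X + x *m model_mx) [set z | exists y : 'rV[R]_m,
      [/\ model_point y, x 0 v / 2 <= y 0 v & y *m model_mx = z - A *m X]].
    have h' : nbhs (A *m X + x *m model_mx - A *m X) [set z | exists y : 'rV[R]_m,
        [/\ model_point y, x 0 v / 2 <= y 0 v & y *m model_mx = z]].
      by rewrite addrAC subrr add0r.
    exact: (ct _ _ h').
  apply: filterS h2 => z [y [ym yd yz]].
  have yU : U y by split=> //; exact/(model_pointP n_gt2).
  have [_ yv] := UP _ yU.
  by exists (f y); [exists y|rewrite XE // yz addrC subrK].
Qed.

(* Barycentric coordinates, in [star_point] below, of the points of the star of
   an outer vertex: the star consists of three consecutive triangles. *)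
Definition star_coef (a b c d : R) : Prop :=
  [/\ 0 <= a, 0 <= b, 0 <= c, 0 <= d &
    [\/ c = 0 /\ d = 0, a = 0 /\ d = 0 | a = 0 /\ b = 0]].

Definition star_point i (a b c d : R) : 'rV[R]_m :=
  (1 - (a + b + c + d)) *: e (outer (ordS i)) + a *: e (outer (ordS (ordS i)))
  + b *: e (inner (ordS i)) + c *: e (inner i) + d *: e (outer i).

Lemma star_point_outer i a b c d :
  star_point i a b c d 0 (outer (ordS i)) = 1 - (a + b + c + d).
Proof.
rewrite !mxE !vertex_eqE !eqxx /= (eq_sym (ordS i) (ordS (ordS i))).
by rewrite !(negPf (ordS_neq n_gt2 _)) /= !mulr0 mulr1 !addr0.
Qed.

Lemma star_model_point i a b c d :
  star_coef a b c d -> a + b + c + d <= 1 -> model_point (star_point i a b c d).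
Proof.
move=> [a0 b0 c0 d0 h] s1; rewrite /star_point.
case: h => -[-> ->]; rewrite !scale0r !addr0.
- by apply: OuterPoint; lra.
- by rewrite addrAC; apply: MiddlePoint; lra.
- rewrite addrC addrA; apply: OuterPoint; lra.
Qed.

Lemma star_pointP i y : model_point y -> 0 < y 0 (outer (ordS i)) ->
  exists a b c d, star_coef a b c d /\ y = star_point i a b c d.
Proof.
case=> j a b c a0 b0 c0 abc; rewrite !mxE !vertex_eqE /= !mulr0 !addr0.
- have [<- _|_] := eqVneq (ordS i) j.
    exists b, c, 0, 0; split; first by split=> //; constructor 1.
    rewrite /star_point !scale0r !addr0; congr (_ *: _ + _ + _); lra.
  rewrite ordS_eq mulr0 add0r; have [<- _|_] := eqVneq i j; last by rewrite mulr0 ltxx.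
  exists 0, 0, c, a; split; first by split=> //; constructor 3.
  rewrite /star_point !scale0r !addr0 [RHS]addrC addrA; congr (_ + _ *: _ + _); lra.
- rewrite ordS_eq; have [<- _|_] := eqVneq i j; last by rewrite mulr0 ltxx.
  exists 0, c, b, 0; split; first by split=> //; constructor 2.
  rewrite /star_point !scale0r !addr0 [RHS]addrAC; congr (_ *: _ + _ + _); lra.
- by rewrite ltxx.
Qed.

Lemma disk_map_star i a b c d (o := p (ordS i)) : f (star_point i a b c d) =
  o + (a *: (p (ordS (ordS i)) - o) + b *: (q (ordS i) - o) + c *: (q i - o) + d *: (p i - o)).
Proof.
rewrite /f !mulmxDl -!scalemxAl !vertex_mxE -/o.
by apply/rowP => k; rewrite !mxE; ring.
Qed.

(** The two equated quantities are the planar coordinates of the combination of [(0, -1)], [(1, 0)],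
    [(1, 1)], [(0, l)]; the three sectors between consecutive vectors overlap only along rays. *)
Lemma star_coef_inj (l a b c d a' b' c' d' : R) : 0 < l ->
  star_coef a b c d -> star_coef a' b' c' d' ->
  b + c = b' + c' -> - a + c + l * d = - a' + c' + l * d' ->
  [/\ a = a', b = b', c = c' & d = d'].
Proof.
move=> l0 [a0 b0 c0 d0 h] [a0' b0' c0' d0' h'] e1 e2.
have ld := mulr_ge0 (ltW l0) d0; have ld' := mulr_ge0 (ltW l0) d0'.
suff [-> -> -> ldE] : [/\ a = a', b = b', c = c' & l * d = l * d'].
  by split=> //; apply: (mulfI (lt0r_neq0 l0)).
by case: h => -[h1 h2]; case: h' => -[h1' h2']; subst; rewrite ?mulr0 in ld ld' e2 *; split; lra.
Qed.

(** The three sectors fill the half plane. The last clause writes the total weight as one formula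
    for all sectors, which makes it visibly continuous in the planar point. *)
Lemma half_plane_star (l u0 u1 : R) : 0 < l -> 0 <= u0 -> exists a b c d,
  [/\ star_coef a b c d, b + c = u0, - a + c + l * d = u1 &
    a + b + c + d = Num.max 0 (- u1) + u0 + Num.max 0 (u1 - u0) / l].
Proof.
move=> l0 u00; have ln0 := lt0r_neq0 l0.
have [u10|u10] := leP u1 0.
  exists (- u1), u0, 0, 0; split; [split=> //; [lra|by constructor 1]|lra|lra|].
  by rewrite max_r ?max_l; lra.
have [u1u|u1u] := leP u1 u0.
  exists 0, (u0 - u1), u1, 0; split; [split=> //; [lra|lra|by constructor 2]|lra|lra|].
  by rewrite max_l ?max_l; lra.
have dl : 0 <= (u1 - u0) / l by rewrite divr_ge0 //; lra.
exists 0, 0, u0, ((u1 - u0) / l); split; [split=> //; by constructor 3|lra| |].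
  by field.
by rewrite max_l ?max_r; lra.
Qed.

(** The point [x] runs over the edge from [P_(i+1)] towards [P_i], without its far end. Such
    half-open edges cover the rim, so vertices and edge points are treated alike, in the star of
    [P_(i+1)]. *)
Lemma boundary_star i d : 0 <= d -> d < 1 ->
  let x := star_point i 0 0 0 d in let v := outer (ordS i) in
  set_inj (star_nbhd x v `&` K) f /\
  flat_at_boundary (f @` (star_nbhd x v `&` K)) (f x).
Proof.
move=> d0 d1 x v; set o := p (ordS i).
have [X [l [rX l0 [X1 X2] X3 X4]]] := boundary_projection n_gt2 G2 i hp.
have xc : star_coef 0 0 0 d by split=> //; constructor 3.
have xv : x 0 v = 1 - d by rewrite star_point_outer !add0r.
have XE a b c k : f (star_point i a b c k) *m X =
    o *m X + ((b + c) *: delta_mx 0 0 + (- a + c + l * k) *: delta_mx 0 1).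
  rewrite disk_map_star !mulmxDl -!scalemxAl X1 X2 X3 X4 -/o.
  by congr (_ + _); apply/rowP => j; rewrite !mxE; ring.
have X0 a b c k : (f (star_point i a b c k) *m X) 0 0 = (o *m X) 0 0 + (b + c).
  by rewrite XE mxE [X in _ + X]mxE !mxE /= mulr1 mulr0 addr0.
have X1' a b c k : (f (star_point i a b c k) *m X) 0 1 = (o *m X) 0 1 + (- a + c + l * k).
  by rewrite XE mxE [X in _ + X]mxE !mxE /= mulr1 mulr0 add0r.
set U := star_nbhd x v `&` K.
have UP y : U y -> exists a b c k, star_coef a b c k /\ y = star_point i a b c k.
  move=> [h /(model_pointP n_gt2) ym]; apply: star_pointP => //.
  by move: h; rewrite /star_nbhd /= xv; lra.
have I : set_inj U ((mulmx^~ X) \o f).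
  move=> y z /[!inE] /UP [a [b [c [k [yc ->]]]]] /UP [a' [b' [c' [k' [zc ->]]]]] /= E.
  have E0 := congr1 (fun M : 'rV[R]_2 => M 0 0) E.
  have E1 := congr1 (fun M : 'rV[R]_2 => M 0 1) E.
  rewrite /= !X0 !X1' in E0 E1.
  move/addrI: E0 => E0; move/addrI: E1 => E1.
  by have [-> -> -> ->] := star_coef_inj l0 yc zc E0 E1.
have [fI XI] := set_inj_comp I; split=> //.
apply: (flat_at_boundary_projection rX) => //.
- apply: continuous_compact; last exact: compact_star_nbhd.
  by apply: continuous_subspaceT; exact: continuous_disk_map.
- exists x => //; split; first by rewrite /star_nbhd /= xv; lra.
  by apply/(model_pointP n_gt2)/star_model_point => //; lra.
- move=> _ [y /UP [a [b [c [k [[_ b0 c0 _ _] ->]]]]] <-].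
  by rewrite !X0; lra.
(* [t z] is the total weight off the vertex [v] of the star point over [z], extended continuously to
   the whole plane. *)
- pose t (z : 'rV[R]_2) : R := Num.max 0 (- (z 0 1 - (o *m X) 0 1)) +
    (z 0 0 - (o *m X) 0 0) +
    Num.max 0 ((z 0 1 - (o *m X) 0 1) - (z 0 0 - (o *m X) 0 0)) / l.
  have cc k : continuous (fun z : 'rV[R]_2 => z 0 k - (o *m X) 0 k).
    apply: continuousBT; last exact: continuous_cstT.
    exact: coord_continuous.
  have ct : continuous t.
    apply: continuousDT.
      apply: continuousDT => //; apply: continuous_maxT; first exact: continuous_cstT.
      by apply: continuousNT.
    apply: continuousMT; last exact: continuous_cstT.
    apply: continuous_maxT; first exact: continuous_cstT.
    exact: continuousBT.
  (* The coordinate of [v] is 1 minus the total weight and must be at least [(1 - d) / 2], whence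
     the threshold [(1 + d) / 2]; at [x] the weight is [d], strictly below it. *)
  have ot : open [set z | t z < (1 + d) / 2] by apply: open_lt_continuous.
  have tx : t (f x *m X) < (1 + d) / 2.
    have ld := mulr_ge0 (ltW l0) d0.
    have xE0 : (f x *m X) 0 0 - (o *m X) 0 0 = 0 by rewrite X0; ring.
    have xE1 : (f x *m X) 0 1 - (o *m X) 0 1 = l * d by rewrite X1'; ring.
    rewrite /t xE0 xE1 subr0 max_l ?oppr_le0 // !add0r max_r //.
    by rewrite mulrAC divff ?lt0r_neq0 // mul1r; lra.
  have nt : nbhs (f x *m X) [set z | t z < (1 + d) / 2].
    by move: ot; rewrite openE => /(_ (f x *m X)); apply.
  apply: filterS nt => z zt z0.
  have z00 : 0 <= z 0 0 - (o *m X) 0 0 by move: z0; rewrite X0; lra.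
  have [a [b [c [k [zc zE0 zE1 zs]]]]] := half_plane_star (z 0 1 - (o *m X) 0 1) l0 z00.
  have s1 : a + b + c + k < (1 + d) / 2 by rewrite zs.
  have yU : U (star_point i a b c k).
    split; first by rewrite /star_nbhd /= xv star_point_outer; lra.
    by apply/(model_pointP n_gt2)/star_model_point => //; lra.
  exists (f (star_point i a b c k)); first by exists (star_point i a b c k).
  by apply: rV2P; rewrite ?X0 ?X1' ?zE0 ?zE1 addrC subrK.
Qed.

(** * The rim: injectivity, disjointness from the interior, and edges *)

Lemma rim_half_open (x : 'rV[R]_m) : @rim R n x -> exists i b,
  [/\ b \in `[(0 : R), 1[ & x = rim_point i (1 - b) b].
Proof.
move=> [i [a [b [a0 b0 ab ->]]]]; have [b1|b1] := ltP b 1.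
  exists i, b; split; first by rewrite in_itv /= b0.
  by congr (rim_point i _ b); lra.
exists (ordS i), 0; split; first by rewrite in_itv /= lexx ltr01.
have [-> ->] : a = 0 /\ b = 1 by split; lra.
by rewrite /rim_point subr0 !scale0r addr0 add0r.
Qed.

Lemma disk_map_rim_inj : set_inj [set x : 'rV[R]_m | @rim R n x] f.
Proof.
have [_ hp'] := hp.
move=> x y /[!inE] /rim_half_open [i [b [b01 ->]]] /rim_half_open [j [c [c01 ->]]].
by rewrite !disk_map_rim => /(hp' i j b c b01 c01) [-> ->].
Qed.

(** A coincidence places a combination of [q i - o] and [q (ordS i) - o] in a subspace spanned by
    differences of polygon vertices; [G3] excludes this for outer triangles and [G2] for middle
    ones, unless the inner weights vanish. *)
Lemma disk_map_eq_rim (x y : 'rV[R]_m) : model_point x -> @rim R n y -> f x = f y -> @rim R n x.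
Proof.
move=> xm [j [c [d [c0 d0 cd ->]]]]; rewrite disk_map_rim.
case: xm => i a b g a0 b0 g0 abg; have [F1 F2 F3] := disk_mapE i a b g.
- rewrite F1 => E; set o := p (ordS i).
  have g00 : g = 0.
    apply: (G3 (i := i) (j := j) (k := ordS j)); rewrite -/o.
    have -> : g *: (q i - o) = (- a) *: (p i - o) + c *: (p j - o) + d *: (p (ordS j) - o).
      have -> : g *: (q i - o) = (a *: p i + b *: p (ordS i) + g *: q i) - o - a *: (p i - o).
        by apply/rowP => k; rewrite !mxE (_ : g = 1 - a - b); [rewrite /o; ring|lra].
      by rewrite E; apply/rowP => k; rewrite !mxE (_ : d = 1 - c); [ring|lra].
    exact: sub_col_mx3.
  by exists i, a, b; split=> //; [lra|rewrite g00 scale0r addr0].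
- rewrite F2 => E; set o := p (ordS i).
  have [b00 g00] : b = 0 /\ g = 0.
    apply: (G2 (i := i) (j := j) (k := ordS j)); rewrite -/o.
    have -> : b *: (q i - o) + g *: (q (ordS i) - o) =
        c *: (p j - o) + d *: (p (ordS j) - o).
      have -> : b *: (q i - o) + g *: (q (ordS i) - o) =
          (a *: p (ordS i) + b *: q i + g *: q (ordS i)) - o.
        by apply/rowP => k; rewrite !mxE (_ : g = 1 - a - b); [rewrite /o; ring|lra].
      by rewrite E; apply/rowP => k; rewrite !mxE (_ : d = 1 - c); [ring|lra].
    exact: sub_col_mx2.
  exists i, 0, 1; split=> //; first by rewrite add0r.
  have -> : a = 1 by lra.
  by rewrite b00 g00 /rim_point !scale0r !addr0 add0r.
(* Projected along the chart attached to the edge [j], the central triangle has gauge at most 1 and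
   the edge has gauge exactly 2. *)
- have [X [_ Xp Xp' Xq]] := interior_projection G1 j.
  have [_ _ h] := triangle_chart i abg Xq.
  move=> /(congr1 (mulmx^~ X)) /=; rewrite h model_mx_central mulmxDl -!scalemxAl Xp Xp'.
  have -> : c *: (A *m X + 2 *: ray j) + d *: (A *m X + 2 *: ray (ordS j)) =
      A *m X + ray_pair j (2 * c) (2 * d).
    by apply/rowP => k; rewrite !mxE (_ : d = 1 - c); [ring|lra].
  move/addrI => /(congr1 (@gauge R n)).
  by rewrite !(gauge_ray_pair n_gt2); lra.
Qed.

Lemma not_rim_vertex (x : 'rV[R]_m) : model_point x -> ~ @rim R n x ->
  exists2 v, (exists i, v = inner i) \/ v = center & 0 < x 0 v.
Proof.
move=> xm nx; apply: contrapT => hn.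
have hi i : x 0 (inner i) <= 0.
  rewrite leNgt; apply/negP => h; apply: hn; exists (inner i) => //; left; by exists i.
have hc : x 0 center <= 0.
  by rewrite leNgt; apply/negP => h; apply: hn; exists center => //; right.
apply: nx; case: xm hi hc => i a b c a0 b0 c0 abc hi.
- have := hi i; rewrite !mxE !vertex_eqE !eqxx /= !mulr0 !add0r mulr1 => c1 _.
  have -> : c = 0 by lra.
  by exists i, a, b; split=> //; [lra|rewrite scale0r addr0].
- have nSi j : (j == ordS j :> 'I_n) = false by rewrite eq_sym (negPf (ordS_neq n_gt2 _)).
  have := hi i; have := hi (ordS i); rewrite !mxE !vertex_eqE !eqxx nSi.
  rewrite (negPf (ordS_neq n_gt2 _)) /= !mulr0 !add0r !mulr1 addr0 => c1 b1 _.
  have [-> [-> ->]] : a = 1 /\ b = 0 /\ c = 0 by do !split; lra.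
  exists i, 0, 1; split=> //; first by rewrite add0r.
  by rewrite /rim_point !scale0r !addr0 add0r.
- have nSi j : (j == ordS j :> 'I_n) = false by rewrite eq_sym (negPf (ordS_neq n_gt2 _)).
  have := hi i; have := hi (ordS i); rewrite !mxE !vertex_eqE !eqxx nSi.
  rewrite (negPf (ordS_neq n_gt2 _)) /= !mulr0 ?add0r ?addr0 !mulr1 => b1 a1 c1.
  by exfalso; lra.
Qed.

Lemma rim_star_point (x : 'rV[R]_m) : @rim R n x -> exists i d,
  [/\ 0 <= d, d < 1 & x = star_point i 0 0 0 d].
Proof.
move=> /rim_half_open [i [b [+ ->]]]; rewrite in_itv /= => /andP[b0 b1].
have [bp|bn] := ltP 0 b.
  exists i, (1 - b); split; [lra|lra|].
  rewrite /star_point /rim_point !scale0r !addr0 !add0r addrC.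
  by congr (_ *: _ + _); lra.
have -> : b = 0 by lra.
(* At the vertex [P_i] itself the star has to be that of index [i], and [star_point] is centred at
   the successor of its index. *)
exists (ord_pred i), 0; split=> //.
by rewrite /star_point /rim_point ord_predK !scale0r !addr0.
Qed.

Lemma star_chart (x : 'rV[R]_m) : K x -> exists v, [/\ 0 < x 0 v,
  set_inj (star_nbhd x v `&` K) f,
  ~ @rim R n x -> flat_at_interior (f @` (star_nbhd x v `&` K)) (f x) &
  @rim R n x -> flat_at_boundary (f @` (star_nbhd x v `&` K)) (f x)].
Proof.
move=> /(model_pointP n_gt2) xm; have [xr|xr] := pselect (@rim R n x).
  have [i [d [d0 d1 xE]]] := rim_star_point xr.
  exists (outer (ordS i)); rewrite xE; have [fI fb] := boundary_star i d0 d1.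
  by split=> //; rewrite ?star_point_outer -?xE //; lra.
have [v hv xv] := not_rim_vertex xm xr; exists v.
have [|fI fi] := interior_star xm _ xv hv; last by split.
rewrite lt_neqAle (gauge_model n_gt2) // andbT; apply/eqP => /(gauge_rim n_gt2 xm).
exact: xr.
Qed.

Lemma segment_rim i :
  f @` [set x | exists a b, [/\ 0 <= a, 0 <= b, a + b = 1 & x = rim_point i a b]]
    = polygon_edge p i.
Proof.
apply/seteqP; split=> [_ [_ [a [b [a0 b0 ab ->]]] <-]|_ [t /= + <-]].
  exists b; first by rewrite /= in_itv /=; apply/andP; split; lra.
  by rewrite disk_map_rim /seg_point; congr (_ *: _ + _); lra.
rewrite in_itv /= => /andP[t0 t1]; exists (rim_point i (1 - t) t).
  by exists (1 - t), t; split=> //; lra.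
by rewrite disk_map_rim.
Qed.

(** The midpoint has positive weight on both vertices, while a point of the rim has weight only on
    two consecutive outer vertices. *)
Lemma rim_edge (s : {set 'I_m}) :
  #|s| = 2%N -> simplex s `<=` [set x : 'rV[R]_m | @rim R n x] ->
  exists i, s = [set outer i; outer (ordS i)]%SET.
Proof.
move=> /eqP /cards2P [u [v [uv ->]]] h.
have [|i [a [b [a0 b0 ab E]]]] := h (2^-1 *: e u + 2^-1 *: e v).
  apply/simplex2P => //; exists 2^-1, 2^-1; split=> //; lra.
have mem w : (2^-1 *: e u + 2^-1 *: e v) 0 w != 0 -> w = outer i \/ w = outer (ordS i).
  rewrite E !mxE /=; have [-> _|_] := eqVneq w (outer i); first by left.
  have [-> _|_] := eqVneq w (outer (ordS i)); first by right.
  by rewrite !mulr0 addr0 eqxx.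
have [hu hv] : (u = outer i \/ u = outer (ordS i)) /\ (v = outer i \/ v = outer (ordS i)).
  split; apply: mem; rewrite !mxE /= eqxx ?(negPf uv) 1?(eq_sym v) ?(negPf uv);
    by rewrite mulr1 mulr0 ?addr0 ?add0r invr_neq0 // pnatr_eq0.
exists i; move: uv; case: hu => ->; case: hv => ->; rewrite ?eqxx // => _.
by rewrite finset.setUC.
Qed.

End spanning_disk.

Theorem theorem1p4 (R : realType) (n : nat) (p : 'I_n -> 'rV[R]_4)
    (hp : closed_polygonal_curve p) :
  exists (m : nat) (S : triangulated_disk R m) (f : 'rV[R]_m -> 'rV[R]_4),
    immersed_PL_disk S f /\ complementary S f /\ locally_flat S f /\
    has_PL_boundary S f p /\ #|triangles S| = (3 * n)%N.
Proof.
have n_gt2 : (2 < n)%N by case: hp.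
have pS i : p i != p (ordS i) by exact: polygon_vertex_neq.
have [A [B1 [B2 [G1 G2 G3]]]] := generic_plane n_gt2 pS.
have [S [ST Sb]] := @model_disk R n n_gt2.
have bE : boundary S = [set x | @rim R n x] by apply/seteqP; split=> x /Sb.
have cE : carrier S = realization (@model_triangles n) by rewrite /carrier ST.
exists (n + n + 1)%N, S, (disk_map p A B1 B2); split; [|split; [|split; [|split]]].
- split=> [t tS|x xS].
    split; first exact: affine_disk_map.
    by apply: (disk_map_simplex_inj n_gt2 G1); rewrite -ST.
  move: xS; rewrite cE => xK.
  have [v [xv fI _ _]] := star_chart n_gt2 hp G1 G2 xK.
  by exists (star_nbhd x v) => //; exact: nbhs_star_nbhd.
- have rimK : [set x : 'rV[R]_(n + n + 1) | @rim R n x] `<=` carrier S.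
    by move=> x xr; rewrite cE; apply/(model_pointP n_gt2)/rim_model_point.
  split.
    rewrite bE; apply: homeomorphism_on_compact => //.
    + have n0 : (0 < n)%N by apply: ltn_trans n_gt2.
      by exists (rim_point (Ordinal n0) 1 0), (Ordinal n0), 1, 0; split; rewrite ?addr0.
    (* As the level set of gauge 2 in the compact complex, the rim is compact. *)
    + have -> : [set x : 'rV[R]_(n + n + 1) | @rim R n x] =
          realization (@model_triangles n) `&` [set x | @gauge R n (x *m model_mx) = 2].
        apply/seteqP; split=> x /=.
          move=> xr; have xm := rim_model_point xr.
          by split; [exact/(model_pointP n_gt2)|exact/(gauge_rim n_gt2 xm)].
        by move=> [/(model_pointP n_gt2) xm /(gauge_rim n_gt2 xm)].
      apply: compact_closedI; first exact: compact_realization.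
      apply: closed_eq_continuous; apply: continuous_compT; last exact: continuous_gauge.
      exact: continuous_model_mx.
    + by apply: continuous_subspaceT; exact: continuous_disk_map.
    + exact: disk_map_rim_inj.
  rewrite bE cE; apply/seteqP; split=> // _ [[x [xK nx] <-] [y yr E]].
  by apply: nx; apply: (disk_map_eq_rim n_gt2 G1 G2 G3 _ yr (esym E)); exact/(model_pointP n_gt2).
- move=> x; rewrite cE => xK.
  have [v [xv fI fi fb]] := star_chart n_gt2 hp G1 G2 xK.
  exists (star_nbhd x v); split.
  + exact: nbhs_star_nbhd.
  + exact: embedding_star_nbhd.
  + by rewrite bE.
  + by rewrite bE.
- have fe i : disk_map p A B1 B2 @` simplex [set outer i; outer (ordS i)]%SET = polygon_edge p i.
    rewrite -(segment_rim p A B1 B2 i); congr image; apply/seteqP; split=> x.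
      by move/simplex2P; apply; rewrite vertex_eqE eq_sym ordS_neq.
    by move=> h; apply/simplex2P => //; rewrite vertex_eqE eq_sym ordS_neq.
  split.
    rewrite bE; apply/seteqP; split=> y.
      move=> [x [i [a [b h]]] <-]; exists i => //; rewrite -(segment_rim p A B1 B2 i).
      by exists x => //; exists a, b.
    move=> [i _]; rewrite -(segment_rim p A B1 B2 i) => -[x [a [b h]] <-].
    by exists x => //; exists i, a, b.
  apply/seteqP; split=> D.
    move=> [s [s2 _ sb] <-]; rewrite bE in sb.
    by have [i ->] := rim_edge s2 sb; exists i => //; rewrite fe.
  move=> [i _ <-]; exists [set outer i; outer (ordS i)]%SET; last exact: fe.
  have iS : outer i != outer (ordS i) by rewrite vertex_eqE eq_sym ordS_neq.
  split; first by rewrite cards2 iS.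
    exists (outer_triangle i); first by rewrite ST; apply/model_triangleP; exists i; constructor 1.
    exact: finset.subsetUl.
  rewrite bE => x /simplex2P [//|a [b h]]; by exists i, a, b.
- by rewrite ST card_model_triangles.
Qed.
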